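(* Let $\mu$ be a translation-invariant, ergodic edge percolation measure on $\mathbb{Z}^2$ which has finitely many infinite clusters almost surely. Then one of the following holds: \begin{itemize} \item Almost surely $\mu_{\mathrm{hp}}$ has a unique infinite cluster and $\mu^*_{\mathrm{hp}}$ has no infinite cluster. \item Almost surely $\mu^*_{\mathrm{hp}}$ has a unique infinite cluster and $\mu_{\mathrm{hp}}$ has no infinite cluster. \item Almost surely neither $\mu_{\mathrm{hp}}$ nor $\mu^*_{\mathrm{hp}}$ has an infinite cluster. \end{itemize}
   Context: Here $\mathbb{Z}^2$ denotes the square lattice graph: the Cayley graph of the group $\mathbb{Z}^2$ with generators $(1,0),(0,1)$, with edge set $E(\mathbb{Z}^2)$. A (spanning) subgraph corresponds to $\omega\in\{0,1\}^{E(\mathbb{Z}^2)}$, where $\omega_e=1$ means $e$ is open (present) and $\omega_e=0$ means $e$ is closed (absent). An edge percolation measure on $\mathbb{Z}^2$ is a probability measure on $\{0,1\}^{E(\mathbb{Z}^2)}$ (product topology, Borel $\sigma$-algebra). A cluster is a connected component of the subgraph of open edges; it is infinite if it has infinitely many vertices. Statements such as ''almost surely $\mu$ has $k$ infinite clusters'' refer to a random subgraph sampled from $\mu$. The group $\mathbb{Z}^2$ acts on $\{0,1\}^{E(\mathbb{Z}^2)}$ by translations. The measure $\mu$ is translation-invariant if it is invariant under this action, and ergodic if it is ergodic with respect to this action. Duality: the planar dual $(\mathbb{Z}^2)^*$ has the plaquettes (unit square faces) of $\mathbb{Z}^2$ as vertices, and each edge $e$ of $\mathbb{Z}^2$ corresponds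 to a dual edge $e^*$ joining the two plaquettes touching $e$. The dual is identified with $\mathbb{Z}^2$ by identifying the vertex $(x,y)$ with the plaquette centered at $(x+1/2,y+1/2)$. The dual $H^*$ of a subgraph $H$ has $e^*$ open if and only if $e$ is closed in $H$. The dual measure $\mu^*$ is the law of $H^*$ when $H$ is sampled from $\mu$, viewed as an edge percolation measure on $\mathbb{Z}^2$ via this identification. $\mu_{\mathrm{hp}}$ denotes the marginal of $\mu$ on the upper half-plane $\mathbb{Z}\times\mathbb{Z}_{\ge 0}$ (i.e., the law of $\omega$ restricted to edges with both endpoints in $\mathbb{Z}\times\mathbb{Z}_{\geq 0}$), and $\mu^*_{\mathrm{hp}}:=(\mu^* )_{\mathrm{hp}}$. *)

(* Defs.v *)
From HB Require Import structures.
From Stdlib Require Import Relation_Operators.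
From mathcomp Require Import all_boot all_order all_algebra.
From mathcomp Require Import all_classical all_reals all_analysis.
Set Implicit Arguments.
Unset Strict Implicit.
Unset Printing Implicit Defensive.
Import Order.TTheory GRing.Theory Num.Theory.
Local Open Scope classical_set_scope.
Local Open Scope ring_scope.

(* The order of the two endpoints is irrelevant: see [open_adjacent]. *)
Record graph := Graph {
  vertex : Type;
  edge : Type;
  endpoints : edge -> vertex * vertex }.

Definition induced_subgraph (G : graph) (S : set (vertex G)) : graph :=
  @Graph {v : vertex G | S v}
    {e : edge G | S (endpoints e).1 /\ S (endpoints e).2}
    (fun e => (exist _ (endpoints (sval e)).1 (proj1 (svalP e)),
               exist _ (endpoints (sval e)).2 (proj2 (svalP e)))).

(* {0,1}^E with the Borel sigma-algebra of the product topology;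
   [w e = true] means that [e] is open. *)
Definition config (G : graph) : Type :=
  g_sigma_algebraType (@open {ptws edge G -> bool}).

HB.instance Definition _ (G : graph) := Measurable.copy (config G)
  (g_sigma_algebraType (@open {ptws edge G -> bool})).

Definition open_adjacent (G : graph) (w : config G) (u v : vertex G) : Prop :=
  exists e : edge G, w e /\ (endpoints e = (u, v) \/ endpoints e = (v, u)).

Definition cluster (G : graph) (w : config G) (v : vertex G) : set (vertex G) :=
  [set u | clos_refl_trans _ (open_adjacent w) v u].

Definition infinite_clusters (G : graph) (w : config G) : set (set (vertex G)) :=
  [set C | (exists v, C = cluster w v) /\ infinite_set C].

Definition finitely_many_infinite_clusters (G : graph) (w : config G) : Prop :=
  finite_set (infinite_clusters w).

Definition unique_infinite_cluster (G : graph) (w : config G) : Prop :=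
  exists! C, infinite_clusters w C.

Definition no_infinite_cluster (G : graph) (w : config G) : Prop :=
  infinite_clusters w = set0.

(* The edge [(v, false)] joins [v] to [v + (1, 0)] and the edge [(v, true)]
   joins [v] to [v + (0, 1)]. *)
Definition Z2 : graph :=
  @Graph (int * int)%type ((int * int) * bool)%type
    (fun e => (e.1, e.1 + (if e.2 then (0, 1) else (1, 0)))).

Definition half_plane : graph :=
  @induced_subgraph Z2 [set v : int * int | 0 <= v.2].

Definition translate (a : int * int) (w : config Z2) : config Z2 :=
  fun e => w (e.1 - a, e.2).

(* The plaquette centered at [(x + 1/2, y + 1/2)] is written [(x, y)].  The edge
   from [(x, y)] to [(x + 1, y)] touches the plaquettes [(x, y - 1)] and
   [(x, y)]; the edge from [(x, y)] to [(x, y + 1)] touches the plaquettes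
   [(x - 1, y)] and [(x, y)]. *)
Definition dual_edge (e : edge Z2) : edge Z2 :=
  if e.2 then (e.1 - (1, 0), false) else (e.1 - (0, 1), true).

Definition primal_edge (e : edge Z2) : edge Z2 :=
  if e.2 then (e.1 + (0, 1), false) else (e.1 + (1, 0), true).

Lemma dual_edgeK : cancel dual_edge primal_edge.
Proof. by move=> [v [] ]; rewrite /primal_edge /dual_edge /= subrK. Qed.

Lemma primal_edgeK : cancel primal_edge dual_edge.
Proof. by move=> [v [] ]; rewrite /primal_edge /dual_edge /= addrK. Qed.

Definition dual_config (w : config Z2) : config Z2 :=
  fun e => ~~ w (primal_edge e).

Lemma dual_configE (w : config Z2) (e : edge Z2) :
  dual_config w (dual_edge e) = ~~ w e.
Proof. by rewrite /dual_config dual_edgeK. Qed.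

Definition restrict_half_plane (w : config Z2) : config half_plane :=
  fun e => w (sval e).

Lemma measurable_reindex (G H : graph) (h : edge H -> edge G)
    (b : bool -> bool) :
  measurable_fun setT (fun w : config G => (fun e => b (w (h e))) : config H).
Proof.
apply: (@measurability _ _ (config G) (config H) setT _
  (@open {ptws edge H -> bool})) => //.
move=> _ [B oB <-]; rewrite setTI; apply: sub_sigma_algebra.
move: B oB.
apply/(@continuousP {ptws edge G -> bool} {ptws edge H -> bool}) => w.
apply/cvg_sup => e U [_ [[V _ <-]] /= Vwe] /filterS; apply.
have /cvg_sup/(_ (h e)) : nbhs (w : {ptws edge G -> bool}) --> w by [].
apply; exists [set w' | V (b (w' (h e)))]; split => //.
by exists (b @^-1` V) => //; exact: discrete_open.
Qed.

HB.instance Definition _ :=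
  isMeasurableFun.Build _ _ (config Z2) (config Z2) dual_config
    (@measurable_reindex Z2 Z2 primal_edge negb).

HB.instance Definition _ :=
  isMeasurableFun.Build _ _ (config Z2) (config half_plane) restrict_half_plane
    (@measurable_reindex Z2 half_plane sval id).

Definition dual_measure (R : realType) (mu : probability (config Z2) R) :
  probability (config Z2) R := distribution mu dual_config.

Definition half_plane_marginal (R : realType) (mu : probability (config Z2) R) :
  probability (config half_plane) R := distribution mu restrict_half_plane.

Definition translation_invariant (R : realType)
    (mu : probability (config Z2) R) : Prop :=
  forall (a : int * int) (A : set (config Z2)), measurable A ->
    mu (translate a @^-1` A) = mu A.

Definition ergodic (R : realType) (mu : probability (config Z2) R) : Prop :=
  forall A : set (config Z2), measurable A ->
    (forall a : int * int, translate a @^-1` A = A) ->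
    mu A = 0%E \/ mu A = 1%E.

(* Main.v *)
Require Import Defs.
From Stdlib Require Import Relation_Operators.
From mathcomp Require Import all_boot all_order all_algebra.
From mathcomp Require Import all_classical all_reals all_analysis.
From mathcomp Require Import zify.
Import Order.TTheory GRing.Theory Num.Theory.
Set Implicit Arguments.
Unset Strict Implicit.
Unset Printing Implicit Defensive.
Local Open Scope classical_set_scope.
Local Open Scope ring_scope.

(** For a row [k], let [H_k] be the half-plane of the sites of height at least
    [k].  The proof compares the clusters of all these half-planes.

    Recurrence and finiteness.  If the plane had an infinite cluster with a
    lowest row, then by Poincaré recurrence along a column
    ([recurrence]) this would happen again above it, and again, each time with
    another lowest row, hence with another cluster; so finiteness of the number
    of infinite clusters excludes it ([ae_no_lowest]).  Consequently an infinite
    cluster of [H_k] cannot stay in [H_k]: it has an exit, that is, an open edge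
    from row [k] to row [k - 1] ([exit_exists]).

    Uniqueness in a half-plane.  By planarity, infinite clusters of [H_k] do not
    cross along row [k] ([noncrossing]).  If there are two of them, then they
    are linearly ordered, each one has a leftmost site on row [k], and by
    recurrence there are infinitely many, in both directions
    ([leftmost_exists]).  An infinite cluster of [H_(k-1)] that has a leftmost
    site then meets row [k - 1] in a finite set, so it contains at least one
    infinite cluster of [H_k] ([leftmost_child]).  Leftmost sites have the same
    density on all rows, so by mass transport it contains exactly one
    ([ae_transported]): the infinite clusters of [H_k] are not joined in
    [H_(k-1)], nor, by induction, in any lower half-plane, nor in the plane.
    This yields infinitely many infinite clusters in the plane, which is absurd
    ([percolation_unique]).

    Duality.  The rest is planar geometry.  If [H_j] has a unique infinite
    cluster, then almost surely its exits recur on both sides of any given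
    plaquette of row [j - 1], and the open path that joins two of them encloses
    that plaquette.  Applied with [j - 1] the lowest row of a dual
    cluster, this shows that all dual clusters of half-planes are finite
    ([ae_dual_blocked]).  If [H_k] has no infinite cluster, then the outer
    boundary of a large finite union of clusters is a connected piece of the
    dual graph, and every infinite dual cluster that starts inside it has to
    cross it; so there is at most one ([dual_percolation_unique]).

    Finally, the event that [H_k] has an infinite cluster decreases with [k] and
    has a probability that does not depend on [k], so it agrees almost surely
    with a translation-invariant event; by ergodicity it has probability 0 or 1,
    for the measure and for its dual ([zero_one]). *)

Notation site := (int * int)%type.

Implicit Types (om : config Z2) (u v z q a : site).

(** * Open adjacency on the square lattice *)

Definition right (v : site) : site := (v.1 + 1, v.2).
Definition up (v : site) : site := (v.1, v.2 + 1).

Definition adj (om : config Z2) (u v : site) : bool :=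
  [|| (v == right u) && om (u, false), (v == up u) && om (u, true),
      (u == right v) && om (v, false) | (u == up v) && om (v, true)].

Variant adj_spec (om : config Z2) (u v : site) : Prop :=
| AdjRight of v = right u & om (u, false)
| AdjUp of v = up u & om (u, true)
| AdjLeft of u = right v & om (v, false)
| AdjDown of u = up v & om (v, true).

Lemma adjP om u v : adj om u v -> adj_spec om u v.
Proof.
by case/or4P => /andP[/eqP h1 h2];
  [constructor 1|constructor 2|constructor 3|constructor 4].
Qed.

Lemma adj_sym om u v : adj om u v = adj om v u.
Proof. by rewrite /adj orbA orbC -!orbA. Qed.

Lemma adj_right om v : om (v, false) -> adj om v (right v).
Proof. by rewrite /adj eqxx => ->. Qed.

Lemma adj_up om v : om (v, true) -> adj om v (up v).
Proof. by rewrite /adj eqxx => ->; rewrite orbT. Qed.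

Lemma open_adjacentE om (u v : site) : @open_adjacent Z2 om u v <-> adj om u v.
Proof.
have rE (x : site) : x + (1, 0) = right x.
  by case: x => a b; rewrite /right/= -[RHS]/(a + 1, b) -[b in RHS]addr0.
have uE (x : site) : x + (0, 1) = up x.
  by case: x => a b; rewrite /up/= -[RHS]/(a, b + 1) -[a in RHS]addr0.
split.
- case=> -[x [] ] /= [we [] [<- <-]]; rewrite ?rE ?uE.
  + exact: adj_up.
  + by rewrite adj_sym; exact: adj_up.
  + exact: adj_right.
  + by rewrite adj_sym; exact: adj_right.
- case/adjP => -> we.
  + by exists (u, false); split => //; left; rewrite /= rE.
  + by exists (u, true); split => //; left; rewrite /= uE.
  + by exists (v, false); split => //; right; rewrite /= rE.
  + by exists (v, true); split => //; right; rewrite /= uE.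
Qed.

(** * Clusters of half-planes *)

Definition step (om : config Z2) (k : int) (u v : site) : bool :=
  [&& k <= u.2, k <= v.2 & adj om u v].

(** The row bound is put on every site of the path, and not on the type of the
    sites, so that the clusters of all the half-planes of one configuration of
    the plane can be compared. *)
Definition conn (om : config Z2) (k : int) (u v : site) : Prop :=
  exists2 p, path (step om k) u p & last u p = v.

Lemma step_sym om k : symmetric (step om k).
Proof. by move=> u v; rewrite /step adj_sym andbCA. Qed.

Lemma conn_refl om k u : conn om k u u.
Proof. by exists [::]. Qed.

Lemma conn_trans om k v u z : conn om k u v -> conn om k v z -> conn om k u z.
Proof.
move=> [p Pp <-] [q Pq <-]; exists (p ++ q); last by rewrite last_cat.
by rewrite cat_path Pp.
Qed.

Lemma conn_step om k u v : step om k u v -> conn om k u v.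
Proof. by move=> s; exists [:: v] => //=; rewrite s. Qed.

Lemma conn_ind om k (P : site -> Prop) u v :
  (forall x y, conn om k u x -> P x -> step om k x y -> P y) ->
  conn om k u v -> P u -> P v.
Proof.
move=> H [p + <-]; elim/last_ind: p => [//|p x IH].
rewrite rcons_path last_rcons => /andP[Pp s] Pu.
by apply: (H _ _ _ _ s); [exists p|exact: IH].
Qed.

Lemma conn_sym om k u v : conn om k u v -> conn om k v u.
Proof.
move=> c; apply: (@conn_ind om k (fun x => conn om k x u) u v _ c).
  2: exact: conn_refl.
move=> x y _ c1 s; apply: conn_trans c1; apply: conn_step.
by rewrite step_sym.
Qed.

Lemma conn_le om k j u v : j <= k -> conn om k u v -> conn om j u v.
Proof.
move=> jk [p Pp e]; exists p => //; apply: sub_path Pp => x y /and3P[h1 h2 h3].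
by rewrite /step (le_trans jk h1) (le_trans jk h2).
Qed.

Lemma conn_above om k u v : conn om k u v -> k <= u.2 -> k <= v.2.
Proof.
move=> c ku; apply: (@conn_ind om k (fun x => k <= x.2) u v _ c) => //.
by move=> x y _ _ /and3P[].
Qed.

(** A path with at least one step stays in the half-plane. *)
Lemma conn_below om k u v : conn om k u v -> u.2 < k -> v = u.
Proof. by move=> [[|y p] /=] => [_ <-//|/andP[/and3P[? _ _] _] _]; lia. Qed.

Lemma cluster_conn om (u v : site) : Defs.cluster om u v <-> exists k, conn om k u v.
Proof.
split.
- elim=> [x y /open_adjacentE a|x|x y z _ [j c1] _ [k c2]].
  + exists (Num.min x.2 y.2); apply: conn_step; rewrite /step a.
    by rewrite !ge_min !lexx orbT.
  + by exists 0; exact: conn_refl.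
  + exists (Num.min j k); apply: (@conn_trans _ _ y).
    * by apply: conn_le c1; rewrite ge_min lexx.
    * by apply: conn_le c2; rewrite ge_min lexx orbT.
- case=> k c; apply: (@conn_ind om k (Defs.cluster om u) u v _ c).
  2: exact: rt_refl.
  move=> x y _ h /and3P[_ _ /open_adjacentE a].
  by apply: rt_trans h _; exact: rt_step.
Qed.

(** * Finite and infinite clusters *)

Definition box (n : nat) (v : site) : bool := (`|v.1| <= n%:Z) && (`|v.2| <= n%:Z).

Lemma finite_box n : finite_set [set v | box n v].
Proof.
pose f (i : 'I_n.*2.+1 * 'I_n.*2.+1) : site :=
  ((i.1 : nat)%:Z - n%:Z, (i.2 : nat)%:Z - n%:Z).
apply: (@sub_finite_set _ _ (f @` setT)); last exact: finite_image.
move=> [x y] /= /andP[/= hx hy].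
have hx' : (absz (x + n%:Z)%R < n.*2.+1)%N by lia.
have hy' : (absz (y + n%:Z)%R < n.*2.+1)%N by lia.
by exists (Ordinal hx', Ordinal hy') => //; rewrite /f /=; congr pair; lia.
Qed.

Lemma box_le m n v : (m <= n)%N -> box m v -> box n v.
Proof. by rewrite /box; lia. Qed.

Lemma box_exists v : exists n, box n v.
Proof. by exists (absz v.1 + absz v.2)%N; rewrite /box; lia. Qed.

Lemma bounded_seq (s : seq site) : exists n, forall v, v \in s -> box n v.
Proof.
elim: s => [|v s [n hn]]; first by exists 0%N.
have [m hm] := box_exists v; exists (maxn m n) => u; rewrite inE => /orP[/eqP->|us].
  by apply: box_le hm; rewrite leq_maxl.
by apply: box_le (hn _ us); rewrite leq_maxr.
Qed.

Lemma finite_setE (A : set site) :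
  finite_set A <-> exists n, forall v, A v -> box n v.
Proof.
split=> [/finite_seqP[s ->]|[n hn]].
  by have [n hn] := bounded_seq s; exists n.
by apply: sub_finite_set (finite_box n).
Qed.

Definition percolates (om : config Z2) (k : int) (v : site) : Prop :=
  infinite_set [set u | conn om k v u].

Lemma percolatesE om k v : percolates om k v <-> forall n, exists2 u, conn om k v u & ~~ box n u.
Proof.
rewrite /percolates; split.
- move=> h n; apply: contrapT => h'; apply: h; apply/finite_setE.
  by exists n => u c; apply/negPn/negP => nb; apply: h'; exists u.
- by move=> h /finite_setE[n hn]; have [u /hn ->] := h n.
Qed.

Lemma percolates_conn om k u v : conn om k u v -> percolates om k u -> percolates om k v.
Proof.
move=> c /percolatesE h; apply/percolatesE => n; have [z c' nb] := h n; exists z => //.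
exact: conn_trans (conn_sym c) c'.
Qed.

Lemma percolates_le om k j v : j <= k -> percolates om k v -> percolates om j v.
Proof.
move=> jk /percolatesE h; apply/percolatesE => n; have [z c' nb] := h n; exists z => //.
exact: conn_le c'.
Qed.

Lemma percolates_above om k v : percolates om k v -> k <= v.2.
Proof.
move=> i; rewrite leNgt; apply/negP => kv; apply: i.
apply: (@sub_finite_set _ _ [set v]); last exact: finite_set1.
by move=> u /conn_below ->.
Qed.

Lemma percolates_cluster om k v : percolates om k v ->
  infinite_set (Defs.cluster om (v : vertex Z2)).
Proof.
by apply: sub_infinite_set => u c; apply/cluster_conn; exists k.
Qed.

(** * Enclosure by a path *)

(** For a step between neighbours, this says that the step is horizontal and lies
    strictly above the plaquette [q], in the column of [q]: along a vertical step
    the two tests of the second factor agree. *)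
Definition cross q u v : bool :=
  (q.2 < u.2) && ((u.1 <= q.1) (+) (v.1 <= q.1)).

(** The parity of the number of crossings with the vertical ray that goes up from
    the centre of the plaquette [q].  For a closed path it is the winding number
    around [q] modulo 2. *)
Fixpoint winding q u (p : seq site) : bool :=
  if p is v :: p' then cross q u v (+) winding q v p' else false.

Definition strictly_above q u : bool := (q.2 < u.2) && (u.1 == q.1).

(** The rays from two plaquettes side by side bound a strip that contains the
    upper half of a column of sites.  The path enters and leaves each inner site
    of it, so crossings of the two rays and vertical steps along the column
    balance modulo 2.  Each vertical step above counts at both of its ends and
    cancels; the step between the two plaquettes would count once, and is the
    one that is closed.  Only the ends of the path are left. *)
Lemma winding_right om k u p q : path (step om k) u p ->
  ~~ om (right q, true) ->
  winding q u p (+) winding (right q) u p =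
  strictly_above (right q) u (+) strictly_above (right q) (last u p).
Proof.
move=> + nq; elim: p u => [|v p IH] u /=; first by rewrite addbb.
case/andP=> /and3P[_ _ /adjP uv] /IH {}IH.
suff E : cross q u v (+) cross (right q) u v =
    strictly_above (right q) u (+) strictly_above (right q) v.
  by rewrite addbACA E IH !addbA addbK.
rewrite /cross /strictly_above.
case: uv => -> /=; rewrite ?addbb ?andbF; try lia.
- move=> e; have : u != right q by apply: contraNneq nq => <-.
  by case: u {IH} e => a b; case: q {nq} => c d e; rewrite xpair_eqE /=; lia.
- move=> e; have : v != right q by apply: contraNneq nq => <-.
  by case: v {IH} e => a b; case: q {nq} => c d e; rewrite xpair_eqE /=; lia.
Qed.

Lemma winding_up om k u p q : path (step om k) u p ->
  ~~ om (up q, false) -> winding q u p = winding (up q) u p.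
Proof.
move=> + nq; elim: p u => [//|v p IH] u /=.
case/andP=> /and3P[_ _ /adjP uv] /IH ->; congr addb.
rewrite /cross.
case: uv => -> /=; rewrite ?addbb ?andbF //.
- move=> e; have : u != up q by apply: contraNneq nq => <-.
  by case: u {IH} e => a b; case: q {nq} => c d e; rewrite xpair_eqE /=; lia.
- move=> e; have : v != up q by apply: contraNneq nq => <-.
  by case: v {IH} e => a b; case: q {nq} => c d e; rewrite xpair_eqE /=; lia.
Qed.

(** Below the path the ray meets every horizontal step of its column, so the
    sum telescopes to the ends of the path. *)
Lemma winding_below om k u p q : path (step om k) u p -> q.2 < k ->
  k <= u.2 -> winding q u p = (u.1 <= q.1) (+) ((last u p).1 <= q.1).
Proof.
move=> + qk; elim: p u => [|v p IH] u /=; first by rewrite addbb.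
move=> /andP[/and3P[ku kv _]] /IH -> // _.
by rewrite /cross (lt_le_trans qk ku) /= addbA addbK.
Qed.

Lemma winding_bounded n q u p : (forall v, v \in u :: p -> box n v) ->
  winding q u p -> (`|q.1| <= n%:Z) && (q.2 <= n%:Z).
Proof.
elim: p u => [//|v p IH] u h /=.
case Hc : (cross q u v) => /=; last first.
  by apply: IH => z zp; apply: h; rewrite inE zp orbT.
move=> _; have hu := h u; have hv := h v; move: hu hv Hc.
rewrite !inE !eqxx !orbT /box /cross => /(_ isT) hu /(_ isT) hv; lia.
Qed.

Lemma winding_cat q u p1 p2 :
  winding q u (p1 ++ p2) = winding q u p1 (+) winding q (last u p1) p2.
Proof. by elim: p1 u => //= v p1 IH u; rewrite IH addbA. Qed.

Lemma dual_configE_right om q : dual_config om (q, false) = ~~ om (right q, true).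
Proof.
rewrite /dual_config /primal_edge /=; congr (~~ om (_, _)).
by case: q => a b; rewrite /right/= -[LHS]/(a + 1, b + 0) addr0.
Qed.

Lemma dual_configE_up om q : dual_config om (q, true) = ~~ om (up q, false).
Proof.
rewrite /dual_config /primal_edge /=; congr (~~ om (_, _)).
by case: q => a b; rewrite /up/= -[LHS]/(a + 0, b + 1) addr0.
Qed.

(** When both ends of the path are on the bottom row, no plaquette of the
    half-plane has them strictly above. *)
Lemma winding_right_eq om k u p q : path (step om k) u p ->
  u.2 = k -> (last u p).2 = k -> k <= q.2 ->
  ~~ om (right q, true) -> winding q u p = winding (right q) u p.
Proof.
move=> Pp uk lk kq /(winding_right Pp).
rewrite /strictly_above uk lk /= ltNge kq /=.
by case: (winding q u p); case: (winding _ u p).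
Qed.

(** An open dual edge crosses a closed edge, which the open path does not use. *)
Lemma winding_dual om k u p q q' : path (step om k) u p ->
  u.2 = k -> (last u p).2 = k -> conn (dual_config om) k q q' -> k <= q.2 ->
  winding q u p = winding q' u p.
Proof.
move=> Pp uk lk c kq.
apply: (@conn_ind _ k (fun x => winding q u p = winding x u p) q q' _ c) => //.
move=> x y _ -> /and3P[kx ky /adjP[] -> ];
  rewrite ?dual_configE_right ?dual_configE_up => o.
- exact: (winding_right_eq Pp uk lk kx o).
- exact: (winding_up Pp o).
- exact: (esym (winding_right_eq Pp uk lk ky o)).
- exact: (esym (winding_up Pp o)).
Qed.

(** With the other clusters closed, a path inside the cluster of [u] avoids all
    the edges at a site of another cluster, and the invariance of the winding
    number applies to the moves from site to site of that other cluster, each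
    site standing for the plaquette of which it is the lower left corner. *)
Definition cluster_config om k u : config Z2 :=
  fun e => om e && `[< conn om k u e.1 >].

Lemma cluster_config_path om k u p :
  path (step om k) u p -> path (step (cluster_config om k u) k) u p.
Proof.
suff H (r : seq site) : path (step om k) u r -> path (step om k) (last u r) p ->
    path (step (cluster_config om k u) k) (last u r) p by apply: (H [::]).
elim: p r => [//|v p IH] r Pq /=.
case/andP=> s Pp; apply/andP; split; last first.
  have := IH (rcons r v); rewrite last_rcons; apply=> //.
  by rewrite rcons_path Pq.
have cl : conn om k u (last u r) by exists r.
have cv : conn om k u v by apply: conn_trans cl (conn_step s).
case/and3P: s => h1 h2 /adjP h3.
rewrite /step h1 h2 /=; case: h3 => e o.
- by rewrite e; apply: adj_right; rewrite /cluster_config o; apply/asboolP.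
- by rewrite e; apply: adj_up; rewrite /cluster_config o; apply/asboolP.
- by rewrite e adj_sym; apply: adj_right; rewrite /cluster_config o; apply/asboolP.
- by rewrite e adj_sym; apply: adj_up; rewrite /cluster_config o; apply/asboolP.
Qed.

(** Together with the line below row [k], a path from [u] to [z] encloses [v].
    If [v] were in another cluster, then this whole cluster would be enclosed,
    and finite. *)
Lemma noncrossing om k u v z : u.2 = k -> v.2 = k -> z.2 = k ->
  u.1 < v.1 -> v.1 < z.1 -> conn om k u z -> percolates om k v -> conn om k u v.
Proof.
move=> uk vk zk uv vz [p Pp pz] iv; apply: contrapT => nuv.
have nc x : conn om k v x -> ~ conn om k u x.
  by move=> vx ux; apply: nuv; apply: conn_trans ux (conn_sym vx).
pose om1 := cluster_config om k u.
have P1 : path (step om1 k) u p by exact: cluster_config_path.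
have om1F b x : ~ conn om k u x -> ~~ om1 (x, b).
  by move=> h; rewrite negb_and; apply/orP; right; apply/asboolPn.
have W0 : winding v u p.
  (* just below row [k] the winding number is that of the ends of the path *)
  pose v' : site := (v.1, v.2 - 1).
  have v'E : up v' = v by rewrite /up /= subrK; case: (v).
  rewrite -v'E -(winding_up P1); last by rewrite v'E om1F.
  rewrite (winding_below P1) ?pz ?uk //=; last by rewrite vk; lia.
  by lia.
have W x : conn om k v x -> winding x u p.
  move=> c; suff -> : winding x u p = winding v u p by [].
  apply: (@conn_ind om k (fun x => winding x u p = winding v u p) v x _ c) => //.
  move=> a b ca <- /and3P[ha hb ab].
  have cb : conn om k v b by apply: conn_trans ca (conn_step _); rewrite /step ha hb.
  have na := nc _ ca; have nb := nc _ cb.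
  have fa t : ~~ om1 (a, t) by exact: om1F.
  have fb t : ~~ om1 (b, t) by exact: om1F.
  case/adjP: ab => e _; rewrite e in fa fb ha hb *.
  - by apply/esym/(winding_right_eq P1); rewrite ?pz.
  - by apply/esym/(winding_up P1).
  - by apply/(winding_right_eq P1); rewrite ?pz.
  - exact: (winding_up P1).
have [n hn] := bounded_seq (u :: p).
move/percolatesE: iv => /(_ (n + absz k)%N)[x vx /negP]; apply.
have := winding_bounded hn (W x vx).
have := conn_above vx; rewrite vk lexx => /(_ isT).
by rewrite /box; lia.
Qed.

(** The path from [u] to [v] is extended down by the two vertical edges: it then
    separates the plaquettes of its inside from the rest of the row of [q], which
    a path that only runs above this row would not do. *)
Lemma dual_enclosed om u v q : u.2 = v.2 -> u.1 <= q.1 -> q.1 < v.1 -> q.2 = u.2 - 1 ->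
  om ((u.1, u.2 - 1), true) -> om ((v.1, v.2 - 1), true) ->
  conn om u.2 u v -> ~ percolates (dual_config om) q.2 q.
Proof.
move=> uv uq qv q2 ou ov [p Pp pv].
pose u' : site := (u.1, u.2 - 1); pose v' : site := (v.1, v.2 - 1).
have uE : up u' = u by rewrite /up /= subrK; case: (u).
have vE : up v' = v by rewrite /up /= subrK; case: (v).
pose p' := u :: rcons p v'.
have P1 : path (step om q.2) u' p'.
  rewrite /p' /= rcons_path pv; apply/and3P; split.
  - by rewrite /step q2 -[in adj _ _ _]uE adj_up //= ; lia.
  - by apply: sub_path Pp => a b /and3P[h1 h2 h3]; rewrite /step h3; lia.
  - by rewrite /step adj_sym -[in adj _ _ _]vE adj_up //= ; lia.
have l1 : last u' p' = v' by rewrite /p' /= last_rcons.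
have W0 : winding q u' p'.
  rewrite /p' -cat1s -cats1 !winding_cat /= pv.
  rewrite (winding_below Pp) // ?pv; last by rewrite q2; lia.
  by rewrite /cross /=; lia.
have [n hn] := bounded_seq (u' :: p').
move=> /percolatesE/(_ (n + absz q.2)%N)[x qx /negP]; apply.
have Wx : winding x u' p'.
  rewrite -(winding_dual P1 _ _ qx) ?l1 //= q2 //; by rewrite uv.
have := winding_bounded hn Wx.
have := conn_above qx (lexx _).
by rewrite /box; lia.
Qed.

(** * Dual percolation among finite clusters *)

Lemma half_plane_connected k u v : k <= u.2 -> k <= v.2 ->
  conn (fun=> true) k u v.
Proof.
suff H x : k <= x.2 -> conn (fun=> true) k x (0, k).
  by move=> /H hu /H hv; apply: conn_trans hu (conn_sym hv).
have vert (a : int) (n : nat) : conn (fun=> true) k (a, k) (a, k + n%:Z).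
  elim: n => [|n IH]; first by rewrite addr0; exact: conn_refl.
  apply: conn_trans IH (conn_step _); rewrite /step /= adj_sym.
  have -> : (a, k + n.+1%:Z) = up (a, k + n%:Z) by rewrite /up /=; congr pair; lia.
  by rewrite adj_sym adj_up //=; lia.
have horr (a : int) (n : nat) : conn (fun=> true) k (a, k) (a + n%:Z, k).
  elim: n => [|n IH]; first by rewrite addr0; exact: conn_refl.
  apply: conn_trans IH (conn_step _); rewrite /step /= adj_sym.
  have -> : (a + n.+1%:Z, k) = right (a + n%:Z, k) by rewrite /right /=; congr pair; lia.
  by rewrite adj_sym adj_right //=; lia.
have hor (a b : int) : a <= b -> conn (fun=> true) k (a, k) (b, k).
  by move=> ab; have -> : b = a + (absz (b - a)%R)%:Z by lia.
case: x => a b /= kb; apply: (@conn_trans _ _ (a, k)).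
  apply: conn_sym; have -> : b = k + (absz (b - k)%R)%:Z by lia.
  exact: vert.
by case: (leP a 0) => h; [apply: hor|apply/conn_sym/hor/ltW].
Qed.

(** Here [t] is the indicator function of a set of sites that is bounded in the
    half-plane, and the cluster of [q] is to be thought of as a dual cluster: a
    plaquette has the same coordinates as its lower left corner, so the two
    alternatives of the conclusion say that the bottom edge or the left edge of
    the plaquette [x] joins the set to its complement. *)
Lemma crossing om k (t : site -> bool) n q :
  (forall v, k <= v.2 -> t v -> box n v) -> k <= q.2 -> t q ->
  percolates om k q -> exists2 x, conn om k q x &
    k <= x.2 /\ ((t x (+) t (right x)) || (t x (+) t (up x))).
Proof.
move=> bt kq tq /percolatesE/(_ n)[z qz /negP nz].
have kz := conn_above qz kq.
apply: contrapT => h; apply: nz; apply: bt => //.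
suff <- : t q = t z by [].
apply: (@conn_ind om k (fun x => t q = t x) q z _ qz) => //.
move=> x y qx -> /and3P[kx ky xy].
have qy : conn om k q y by apply: conn_trans qx (conn_step _); rewrite /step kx ky.
have H a : conn om k q a -> k <= a.2 -> t a = t (right a) /\ t a = t (up a).
  move=> qa ka; have /negP : ~ ((t a (+) t (right a)) || (t a (+) t (up a))).
    by move=> ?; apply: h; exists a.
  by case: (t a); case: (t (right a)); case: (t (up a)).
by case/adjP: xy => e _; rewrite {1}e;
  case: (H _ qx kx) => h1 h2; case: (H _ qy ky) => h3 h4; rewrite ?e -?h1 -?h2 -?h3 -?h4.
Qed.

Lemma big_addb_telescope (a : nat -> bool) N :
  \big[addb/false]_(0 <= i < N) (a i (+) a i.+1) = a 0%N (+) a N.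
Proof.
elim: N => [|N IH]; first by rewrite big_geq // addbb.
by rewrite big_nat_recr //= IH addbA addbK.
Qed.

(** Let [f] be the indicator function of the finite union of the clusters that
    meet a lattice path from [p1] to [p2].  Its boundary edges are closed, hence
    open in the dual.  Among them, those whose dual edge is in the dual cluster
    of [p1] meet the boundary of each plaquette an even number of times, because
    the boundary edges of one plaquette belong to the same dual cluster.  The
    half-plane is simply connected, so they are the boundary of a set: its
    indicator function [psi] is obtained by summation along the columns.  As the
    lattice path has no boundary edge, [psi] is constant on it.
    If [psi] is 1 there, the cluster of [p2] must cross the boundary of [psi],
    which is part of the cluster of [p1].  If [psi] is 0 there, then [f + psi] is
    1 at [p1], and the cluster of [p1] must cross the boundary of [f + psi],
    from which all its edges have been removed; this is absurd. *)
Lemma dual_percolation_unique om k p1 p2 : (forall v, ~ percolates om k v) ->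
  percolates (dual_config om) k p1 -> percolates (dual_config om) k p2 ->
  conn (dual_config om) k p1 p2.
Proof.
move=> fin perc1 perc2.
have k1 := percolates_above perc1; have k2 := percolates_above perc2.
have [r Pr lr] := half_plane_connected k1 k2.
pose f v := `[< exists2 b, b \in p1 :: r & conn om k b v >].
have kr b : b \in p1 :: r -> k <= b.2.
  elim: r (p1) k1 Pr {lr f perc1} => [|y r IH] x kx /=.
    by move=> _; rewrite inE => /eqP->.
  by case/andP => /and3P[_ ky _] /IH {}IH; rewrite inE => /orP[/eqP->//|/IH]; apply.
have [n fn] : exists n, forall v, f v -> box n v.
  have /finite_setE[n hn] : finite_set (\bigcup_(b in [set` p1 :: r]) [set v | conn om k b v]).
    by apply: bigcup_finite => // b _; apply: contrapT => /fin.
  by exists n => v /asboolP[b br bv]; apply: hn; exists b.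
have fr b : b \in p1 :: r -> f b by move=> br; apply/asboolP; exists b => //; exact: conn_refl.
have fconn u v : step om k u v -> f u = f v.
  move=> s; apply/asboolP/asboolP => -[b br c]; exists b => //.
    by apply: conn_trans c (conn_step s).
  by apply: conn_trans c (conn_step _); rewrite step_sym.
pose d q := `[< conn (dual_config om) k p1 q >].
have dconn u v : step (dual_config om) k u v -> d u = d v.
  move=> s; apply/asboolP/asboolP => c.
    by apply: conn_trans c (conn_step s).
  by apply: conn_trans c (conn_step _); rewrite step_sym.
pose phv v := (f v (+) f (up v)) && d v.
pose phh v := (f v (+) f (right v)) && d v.
(* the bottom and left edges of a plaquette are attributed to the dual cluster of
   that plaquette; on a boundary edge both of its plaquettes agree *)
have square q : k <= q.2 -> phv q (+) phv (right q) = phh q (+) phh (up q).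
  move=> kq; rewrite /phv /phh.
  have E1 : (f (right q) (+) f (up (right q))) && d (right q) =
            (f (right q) (+) f (up (right q))) && d q.
    case fe : (_ (+) _) => //=; apply/esym/dconn.
    rewrite /step /= kq /=; apply: adj_right; rewrite dual_configE_right.
    apply: contraTN fe => o; rewrite (@fconn (right q) (up (right q))) ?addbb //.
    by rewrite /step /= kq (adj_up o); lia.
  have E2 : (f (up q) (+) f (right (up q))) && d (up q) =
            (f (up q) (+) f (right (up q))) && d q.
    case fe : (_ (+) _) => //=; apply/esym/dconn.
    rewrite /step kq /=; apply/andP; split; first by lia.
    apply: adj_up; rewrite dual_configE_up.
    apply: contraTN fe => o; rewrite (@fconn (up q) (right (up q))) ?addbb //.
    by rewrite /step /= (adj_right o); lia.
  rewrite E1 E2; have -> : up (right q) = right (up q) by [].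
  by case: (d q); case: (f q); case: (f (up q)); case: (f (right q)); case: (f (right (up q))).
(* above height [n] there is no boundary edge, and [N] rows above row [k] suffice
   to get there *)
pose N := (n + absz k).+1.
pose psi v := \big[addb/false]_(0 <= i < N) phv (v.1, v.2 + i%:Z).
have upi (a b : int) (i : nat) : up (a, b + i%:Z) = (a, b + i.+1%:Z).
  by rewrite /up /=; congr pair; lia.
have high v : k <= v.2 -> forall c : int, f (c, v.2 + N%:Z) = false.
  by move=> kv c; apply/negP => /fn; rewrite /box /N /=; lia.
have psi_up v : k <= v.2 -> psi v (+) psi (up v) = phv v.
  move=> kv; rewrite /psi -big_split /=.
  under eq_bigr => i _.
    have -> : v.2 + 1 + i%:Z = v.2 + i.+1%:Z by lia.
    over.
  rewrite (big_addb_telescope (fun i => phv (v.1, v.2 + i%:Z))) addr0.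
  rewrite {2}/phv high // upi.
  have -> : v.2 + N.+1%:Z = (up v).2 + N%:Z by rewrite /=; lia.
  by rewrite high /= ?addbF; [case: (v)|lia].
have psi_right v : k <= v.2 -> psi v (+) psi (right v) = phh v.
  move=> kv; rewrite /psi -big_split /=.
  under eq_bigr => i _.
    have -> : (v.1 + 1, v.2 + i%:Z) = right (v.1, v.2 + i%:Z) by [].
    rewrite square /= ?upi; last by lia.
    over.
  rewrite (big_addb_telescope (fun i => phh (v.1, v.2 + i%:Z))) addr0.
  by rewrite {2}/phh /right /= !high //= addbF; case: (v).
have psi_n v : k <= v.2 -> psi v -> box (n + absz k) v.
  move=> kv; apply: contraTT => nb; rewrite /psi big1 // => i _.
  suff F (j : nat) : f (v.1, v.2 + j%:Z) = false by rewrite /phv upi !F.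
  by apply/negP => /fn; move: nb; rewrite /box /=; lia.
have psi_const : psi p1 = psi p2.
  have : path (step (fun=> true) k) p1 r && all f (p1 :: r).
    by rewrite Pr; apply/allP => b /fr.
  rewrite -lr; elim: (r) (p1) => [//|y s IH] x /=.
  case/andP => /andP[/and3P[kx ky xy] Ps] /and3P[fx fy fs].
  rewrite -(IH y); last by rewrite Ps /= fy fs.
  suff : psi x (+) psi y = false by case: (psi x); case: (psi y).
  case/adjP: xy => e _; rewrite e in fx fy kx ky *.
  - by rewrite psi_right // /phh fx fy.
  - by rewrite psi_up // /phv fx fy.
  - by rewrite addbC psi_right // /phh fx fy.
  - by rewrite addbC psi_up // /phv fx fy.
case psi1 : (psi p1).
  have [|x c [kx]] := crossing psi_n k2 _ perc2; first by rewrite -psi_const.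
  rewrite psi_right // psi_up // /phh /phv -andb_orl => /andP[_ /asboolP c1].
  exact: conn_trans c1 (conn_sym c).
have tn v : k <= v.2 -> f v (+) psi v -> box (n + absz k) v.
  move=> kv; case fv : (f v); last exact: psi_n.
  by move=> _; apply: box_le (fn _ fv); rewrite leq_addr.
have [|x c [kx]] := crossing tn k1 _ perc1; first by rewrite psi1 fr // mem_head.
have dx : d x by apply/asboolP.
rewrite 2!(addbACA (f x) (psi x)) psi_right // psi_up // /phh /phv dx !andbT.
by rewrite !addbb.
Qed.

(** * Probability spaces *)

Section measure.
Context {d : measure_display} {T : measurableType d} {R : realType}.
Variable mu : probability T R.

(** If the common value were positive, then some partial sum of the probabilities
    of these disjoint events would exceed 1. *)
Lemma equal_disjoint_null (F : nat -> set T) :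
  (forall n, measurable (F n)) -> trivIset setT F ->
  (forall n, mu (F n) = mu (F 0%N)) -> mu (F 0%N) = 0%E.
Proof.
move=> mF tF eF.
have mF0 := mF 0%N; have : mu (F 0%N) \is a fin_num by apply: fin_num_measure.
have H N : (\sum_(i < N) mu (F 0%N) <= 1)%E.
  rewrite (eq_bigr (fun i : 'I_N => mu (F i))); last by move=> i _; rewrite eF.
  rewrite -measure_bigsetU_ord //; last first.
    by move=> i j _ _ ij; apply/val_inj/tF.
  by apply: probability_le1; apply: bigsetU_measurable.
have : (0 <= mu (F 0%N))%E by [].
move: H; case: (mu (F 0%N)) => [r| |] //.
move=> H; rewrite lee_fin => r0 _; congr EFin; apply/eqP; rewrite eq_le r0 andbT leNgt.
apply/negP => rp; have := H (Num.bound r^-1).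
rewrite sumEFin lee_fin sumr_const card_ord -mulr_natl.
apply/negP; rewrite -ltNge -ltr_pdivrMr // mul1r.
by apply: (le_lt_trans _ (archi_boundP _)); rewrite ?invr_ge0.
Qed.

(** This is the mass-transport principle in disguise: [F i] is meant to be the
    event that the origin of a row sends its mass by the displacement [i], and
    [G i] the event that the origin of another row receives mass from the
    displacement [- i]. *)
Lemma equal_disjoint_le (I : countType) (F G : I -> set T) :
  (forall i, measurable (F i)) -> (forall i, measurable (G i)) ->
  (forall i, mu (F i) = mu (G i)) -> trivIset setT G ->
  (mu (\bigcup_i F i) <= mu (\bigcup_i G i))%E.
Proof.
move=> mF mG eFG tG.
pose ext (H : I -> set T) n := if @pickle_inv I n is Some i then H i else set0.
have extE (H : I -> set T) : \bigcup_i H i = \bigcup_n ext H n.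
  apply/seteqP; split=> [x [i _ Hi]|x [n _]].
    by exists (pickle i) => //; rewrite /ext pickleK_inv.
  by rewrite /ext; case: pickle_inv => // i Hi; exists i.
have mext (H : I -> set T) : (forall i, measurable (H i)) -> forall n, measurable (ext H n).
  by move=> mH n; rewrite /ext; case: pickle_inv.
rewrite !extE (@measure_bigcup _ _ _ mu setT (ext G)).
- rewrite (@eq_eseriesl _ _ predT); last by move=> i; rewrite in_setT.
  rewrite -(@eq_eseriesr _ (fun n => mu (ext F n))); last first.
    by move=> n _; rewrite /ext; case: pickle_inv.
  apply: measure_sigma_subadditive => //; first exact: mext.
  by apply: bigcupT_measurable; exact: mext.
- by move=> i _; exact: mext.
- move=> m n _ _ []; rewrite /ext => x.
  have := @pickle_invK I m; have := @pickle_invK I n.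
  case: (pickle_inv m) => [i|]; case: (pickle_inv n) => [j|] //= jn im; try by case.
  by move=> ij; rewrite -im -jn; congr pickle; apply: tG => //; exists x.
Qed.

Lemma ae_mp (P Q : T -> Prop) : (forall x, P x -> Q x) ->
  {ae mu, forall x, P x} -> {ae mu, forall x, Q x}.
Proof. by move=> PQ; apply: filterS. Qed.

Lemma ae_and (P Q : T -> Prop) : {ae mu, forall x, P x} ->
  {ae mu, forall x, Q x} -> {ae mu, forall x, P x /\ Q x}.
Proof. by move=> h1 h2; apply: filterS2 h1 h2. Qed.

Lemma ae_forall (I : countType) (P : I -> T -> Prop) :
  (forall i, {ae mu, forall x, P i x}) -> {ae mu, forall x, forall i, P i x}.
Proof.
move=> h.
pose Q n x := if @pickle_inv I n is Some i then P i x else True.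
have /ae_foralln : forall n, \forall x \ae mu, Q n x.
  move=> n; rewrite /Q; case: pickle_inv => [i|]; first exact: h.
  exact: aeW.
by apply: ae_mp => x + i => /(_ (pickle i)); rewrite /Q pickleK_inv.
Qed.

Lemma ae_null (P : T -> Prop) : measurable [set x | ~ P x] ->
  mu [set x | ~ P x] = 0%E -> {ae mu, forall x, P x}.
Proof. by move=> mP P0; exists [set x | ~ P x]; split. Qed.

Lemma le_of_ae (A B : set T) : measurable A -> measurable B ->
  {ae mu, forall x, A x -> B x} -> (mu A <= mu B)%E.
Proof.
move=> mA mB h; rewrite (measureDI mu mA mB).
rewrite [X in (X + _)%E](_ : _ = 0%E) ?add0e ?measureIr //.
apply: measure_negligible; first exact: measurableD.
by apply: negligibleS h => x [Ax nB] /= /(_ Ax).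
Qed.

Lemma ae_of_le (A B : set T) : measurable A -> measurable B -> B `<=` A ->
  (mu A <= mu B)%E -> {ae mu, forall x, A x -> B x}.
Proof.
move=> mA mB BA le; exists (A `\` B); split; first exact: measurableD.
  have fB : mu B \is a fin_num by exact: fin_num_measure.
  rewrite measureD //; last by rewrite ltey_eq fin_num_measure.
  rewrite (setIidr BA) [X in (X - _)%E](_ : _ = mu B) ?subee //.
  by apply/eqP; rewrite eq_le le /= le_measure // inE.
by move=> x /= /not_implyP.
Qed.

Lemma measurable_forall (I : countType) (P : I -> T -> Prop) :
  (forall i, measurable [set x | P i x]) -> measurable [set x | forall i, P i x].
Proof.
move=> h; have -> : [set x | forall i, P i x] = ~` \bigcup_i ~` [set x | P i x].
  rewrite setC_bigcup; apply/seteqP; split=> x /= => [H i _|H i]; first by rewrite setCK; exact: H.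
  by have := H i Logic.I; rewrite setCK.
apply/measurableC/countable_bigcupT_measurable => // i.
exact: measurableC.
Qed.

Lemma measurable_not (P : T -> Prop) :
  measurable [set x | P x] -> measurable [set x | ~ P x].
Proof. exact: measurableC. Qed.

Lemma measurable_exists (I : countType) (P : I -> T -> Prop) :
  (forall i, measurable [set x | P i x]) -> measurable [set x | exists i, P i x].
Proof.
move=> h; have -> : [set x | exists i, P i x] = \bigcup_i [set x | P i x].
  by apply/seteqP; split=> x [i Pi]; exists i.
by apply/countable_bigcupT_measurable.
Qed.

Lemma measurable_and (P Q : T -> Prop) : measurable [set x | P x] ->
  measurable [set x | Q x] -> measurable [set x | P x /\ Q x].
Proof. exact: measurableI. Qed.

Lemma measurable_or (P Q : T -> Prop) : measurable [set x | P x] ->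
  measurable [set x | Q x] -> measurable [set x | P x \/ Q x].
Proof. exact: measurableU. Qed.

Lemma measurable_cond (b : Prop) (P : T -> Prop) : (b -> measurable [set x | P x]) ->
  measurable [set x | b -> P x].
Proof.
move=> h; have [hb|hb] := pselect b.
  have -> : [set x | b -> P x] = [set x | P x].
    by apply/seteqP; split=> [x /= /(_ hb)|x /= Px _].
  exact: h hb.
by have -> : [set x | b -> P x] = setT by apply/seteqP; split=> [x|x _ /hb].
Qed.

Lemma measurable_imp (P Q : T -> Prop) : measurable [set x | P x] ->
  measurable [set x | Q x] -> measurable [set x | P x -> Q x].
Proof.
move=> mP mQ; have -> : [set x | P x -> Q x] = ~` [set x | P x] `|` [set x | Q x].
  by apply/seteqP; split=> x /=; have [] := pselect (P x); tauto.
by apply: measurableU => //; exact: measurableC.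
Qed.

Lemma measurable_iff (P Q : T -> Prop) : (forall x, P x <-> Q x) ->
  measurable [set x | P x] -> measurable [set x | Q x].
Proof. by move=> h; congr measurable; apply/funext => x; apply/propext. Qed.

Lemma measurable_const (b : Prop) : measurable [set x : T | b].
Proof.
have [hb|hb] := pselect b.
  by have -> : [set x : T| b] = setT by apply/seteqP; split.
by have -> : [set x : T| b] = set0 by apply/seteqP; split.
Qed.

End measure.

Section pushforward.
Context {d d' : measure_display} {T : measurableType d} {T' : measurableType d'}
  {R : realType}.
Variables (mu : probability T R) (f : {mfun T >-> T'}).

Lemma ae_distribution (P : T' -> Prop) : measurable [set y | P y] ->
  {ae mu, forall x, P (f x)} -> {ae distribution mu f, forall y, P y}.
Proof.
move=> mP h; exists (~` [set y | P y]); split => //; first exact: measurableC.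
apply: (@measure_negligible _ _ _ mu); last exact: h.
rewrite -[X in measurable X]setTI.
by apply: measurable_funPT => //; exact: measurableC.
Qed.

Lemma ae_distribution_inv (P : T' -> Prop) :
  {ae distribution mu f, forall y, P y} -> {ae mu, forall x, P (f x)}.
Proof.
case=> N [mN N0 PN]; exists (f @^-1` N); split => //.
  by rewrite -[X in measurable X]setTI; apply: measurable_funPT.
by move=> x /= nP; apply: PN.
Qed.

End pushforward.

(** * Measurability of connection events *)

Lemma measurable_open (e : edge Z2) : measurable [set om : config Z2 | om e].
Proof.
apply: sub_sigma_algebra.
have -> : [set om : config Z2 | om e] =
    (fun om : {ptws edge Z2 -> bool} => om e) @^-1` [set true].
  by apply/seteqP; split=> x /=.
have /continuousP : continuous (fun om : {ptws edge Z2 -> bool} => om e).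
  exact: (@proj_continuous _ (fun=> bool) e).
by apply; exact: discrete_open.
Qed.

Lemma measurable_adj u v : measurable [set om : config Z2 | adj om u v].
Proof.
apply: (@measurable_iff _ _ (fun om : config Z2 =>
  ((v == right u /\ om (u, false)) \/ (v == up u /\ om (u, true))) \/
  ((u == right v /\ om (v, false)) \/ (u == up v /\ om (v, true))))).
  move=> om; rewrite /adj; split.
    by case=> -[] [-> ->]; rewrite ?orbT.
  by case/or4P => /andP; tauto.
by do 2 apply: measurable_or; apply: measurable_and;
  (exact: measurable_const || exact: measurable_open).
Qed.

Lemma measurable_conn k u v : measurable [set om | conn om k u v].
Proof.
apply: (@measurable_iff _ _ (fun om => exists p : seq site, path (step om k) u p /\ last u p = v)).
  by move=> om; split=> [[p []]|[p]]; exists p.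
apply: measurable_exists => p; apply: measurable_and; last exact: measurable_const.
elim: p u => [|x p IH] u /=; first exact: measurable_const.
apply: (@measurable_iff _ _ (fun om => (k <= u.2 /\ k <= x.2) /\
    (adj om u x /\ path (step om k) x p))).
  move=> om; rewrite /step; split.
    by case=> [[-> ->] [-> ->]].
  by case/andP => /and3P[-> -> ->] ->.
apply: measurable_and; first exact: measurable_const.
by apply: measurable_and; first exact: measurable_adj.
Qed.

Lemma measurable_percolates k v : measurable [set om | percolates om k v].
Proof.
apply: (@measurable_iff _ _ (fun om => forall n, exists u, conn om k v u /\ ~~ box n u)).
  move=> om; rewrite percolatesE; split=> h n; have := h n; first by move=> [u []]; exists u.
  by case=> u; exists u.
apply: measurable_forall => n; apply: measurable_exists => u.
by apply: measurable_and; [exact: measurable_conn|exact: measurable_const].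
Qed.

(** * Translations and recurrence *)

Lemma site_eq (u v : site) : u.1 = v.1 -> u.2 = v.2 -> u = v.
Proof. by case: u => ? ?; case: v => ? ? /= -> ->. Qed.

Lemma translateN a om : translate (- a) (translate a om) = om.
Proof. by apply/funext => -[v b]; rewrite /translate /= opprK addrK. Qed.

Lemma rightB v a : right v - a = right (v - a).
Proof. by apply: site_eq => /=; lia. Qed.

Lemma upB v a : up v - a = up (v - a).
Proof. by apply: site_eq => /=; lia. Qed.

Lemma adj_translate a om u v : adj (translate a om) u v = adj om (u - a) (v - a).
Proof. by rewrite /adj -!rightB -!upB !(inj_eq (addIr (- a))). Qed.

Lemma conn_translate a om k u v :
  conn (translate a om) k u v <-> conn om (k - a.2) (u - a) (v - a).
Proof.
suff H b om' j x y : conn (translate b om') j x y ->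
    conn om' (j - b.2) (x - b) (y - b).
  split; first exact: H.
  by rewrite -{1}(translateN a om) => /H /=; rewrite !opprK !subrK.
move=> c; apply: (@conn_ind _ _ (fun y => conn om' (j - b.2) (x - b) (y - b)) _ _ _ c).
  2: exact: conn_refl.
move=> s t _ h /and3P[h1 h2]; rewrite adj_translate => st.
by apply: conn_trans h (conn_step _); rewrite /step st /=; lia.
Qed.

Lemma percolates_translate a om k v :
  percolates (translate a om) k v <-> percolates om (k - a.2) (v - a).
Proof.
suff H b om' j x : percolates (translate b om') j x -> percolates om' (j - b.2) (x - b).
  split; first exact: H.
  by rewrite -{1}(translateN a om) => /H /=; rewrite !opprK !subrK.
move/percolatesE => h; apply/percolatesE => n.
have [u /conn_translate c nu] := h (n + absz b.1 + absz b.2)%N.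
by exists (u - b) => //; move: nu; rewrite /box /=; lia.
Qed.

Definition equivariant (Q : config Z2 -> site -> Prop) :=
  forall a om v, Q (translate a om) v <-> Q om (v - a).

Lemma fstMn (a : site) n : (a *+ n).1 = a.1 *+ n.
Proof. by elim: n => // n IH; rewrite !mulrS /= IH. Qed.

Lemma sndMn (a : site) n : (a *+ n).2 = a.2 *+ n.
Proof. by elim: n => // n IH; rewrite !mulrS /= IH. Qed.

Section stationary.
Context {R : realType}.
Variable mu : probability (config Z2) R.
Hypothesis mu_inv : translation_invariant mu.

Lemma equivariant_prob Q u v : equivariant Q ->
  measurable [set om | Q om u] -> mu [set om | Q om v] = mu [set om | Q om u].
Proof.
move=> eQ mQ; rewrite -(mu_inv (u - v) mQ); congr (mu _).
by apply/funext => om; apply/propext; rewrite /preimage /= eQ opprB addrCA subrr addr0.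
Qed.

(** Poincaré recurrence.  Take the event that [Q] holds at [v] and at none of the
    sites [v + a *+ n.+1].  Its translates by the multiples of [a] are pairwise
    disjoint and have the same probability. *)
Lemma recurrence (Q : config Z2 -> site -> Prop) a : equivariant Q ->
  (forall v, measurable [set om | Q om v]) ->
  {ae mu, forall om, forall v, Q om v -> exists n, Q om (v + a *+ n.+1)}.
Proof.
move=> eQ mQ; apply: (@ae_forall _ _ _ _ _ (fun v om => Q om v ->
  exists n, Q om (v + a *+ n.+1))) => v.
pose L om u := ~ (Q om u -> exists n, Q om (u + a *+ n.+1)).
have eL : equivariant L.
  move=> b om u; rewrite /L eQ.
  have -> : (exists n, Q (translate b om) (u + a *+ n.+1)) <->
      (exists n, Q om (u - b + a *+ n.+1)).
    by split=> -[n h]; exists n; move: h; rewrite eQ addrAC.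
  by [].
have mL u : measurable [set om | L om u].
  apply: measurable_not; apply: measurable_imp => //.
  by apply: measurable_exists => n.
pose F n := [set om | L om (v + a *+ n)].
have F0 : F 0%N = [set om | L om v] by rewrite /F mulr0n addr0.
suff L0 : mu (F 0%N) = 0%E by apply: (ae_null (mL v)); rewrite -F0.
apply: equal_disjoint_null => [n||n].
- exact: mL.
- apply/trivIsetP => m n _ _.
  wlog: m n / (m < n)%N => [H|mn _].
    by rewrite neq_ltn => /orP[] h; [|rewrite setIC]; apply: H => //; rewrite neq_ltn h ?orbT.
  apply/seteqP; split=> // om [Fm Fn]; apply: Fm => _.
  have [Qn _] : Q om (v + a *+ n) /\ True.
    by split => //; apply: contrapT => h; apply: Fn => /h.
  by exists (n - m).-1; rewrite -addrA -mulrnDr; have -> : (m + (n - m).-1.+1 = n)%N by lia.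
- by apply: equivariant_prob.
Qed.

End stationary.

(** * Recurrent families of sites *)

Lemma int_min (P : int -> Prop) (k x : int) : (forall y, P y -> k <= y) -> P x ->
  exists2 m, P m & forall y, P y -> m <= y.
Proof.
move=> bP Px; have kx := bP _ Px.
pose p (n : nat) := `[< P (k + n%:Z) >].
have e : exists n, p n.
  by exists (absz (x - k)%R); apply/asboolP; have -> : k + (absz (x - k)%R)%:Z = x by lia.
have [m /asboolP Pm mmin] := ex_minnP e.
exists (k + m%:Z) => // y Py; have ky := bP _ Py.
have := mmin (absz (y - k)%R).
have -> : p (absz (y - k)%R).
  by apply/asboolP; have -> : k + (absz (y - k)%R)%:Z = y by lia.
by move=> /(_ isT); lia.
Qed.

Definition recurrent (a : site) (Q : site -> Prop) :=
  forall v, Q v -> exists n, Q (v + a *+ n.+1).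

Lemma recurrent_far a Q v M : recurrent a Q -> Q v ->
  exists2 m, (M <= m)%N & Q (v + a *+ m).
Proof.
move=> rQ Qv; elim: M => [|M [m Mm Qm]]; first by exists 0%N; rewrite ?mulr0n ?addr0.
have [n Qn] := rQ _ Qm; exists (m + n.+1)%N; first by lia.
by rewrite mulrnDr addrA.
Qed.

Lemma addr_right v n : v + (1, 0) *+ n = (v.1 + n%:Z, v.2).
Proof. by apply: site_eq; rewrite /= ?fstMn ?sndMn /=; lia. Qed.

Lemma addr_left v n : v + (-1, 0) *+ n = (v.1 - n%:Z, v.2).
Proof. by apply: site_eq; rewrite /= ?fstMn ?sndMn /=; lia. Qed.

Lemma addr_up v n : v + (0, 1) *+ n = (v.1, v.2 + n%:Z).
Proof. by apply: site_eq; rewrite /= ?fstMn ?sndMn /=; lia. Qed.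

(** The hypotheses embed the family into the finite set of infinite clusters,
    whereas a recurrent family is unbounded. *)
Lemma no_recurrent_family om a Q : finitely_many_infinite_clusters om ->
  a = (1, 0) \/ a = (0, 1) ->
  (forall v, Q v -> infinite_set (Defs.cluster om (v : vertex Z2))) ->
  (forall u v, Q u -> Q v -> Defs.cluster om (u : vertex Z2) v -> u = v) ->
  recurrent a Q -> forall v, ~ Q v.
Proof.
move=> fin ha Qinf Qinj rQ v Qv.
have /finite_setE[n hn] : finite_set [set v | Q v].
  pose C v := Defs.cluster om (v : vertex Z2).
  have : finite_set (C @` [set v | Q v]).
    apply: sub_finite_set fin => _ [u /= Qu <-]; split; first by exists u.
    exact: Qinf.
  rewrite (eq_finite_set (inj_card_eq _)) // => x y.
  rewrite !inE /= => Qx Qy e; apply: Qinj => //.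
  by rewrite -/(C x y) e; exact: rt_refl.
have [m nm /hn] := recurrent_far (n + n + absz v.1 + absz v.2).+1 rQ Qv.
by case: ha => ->; rewrite ?addr_right ?addr_up /box /=; lia.
Qed.

(** * Lowest rows, exits and leftmost sites *)

(** The infinite clusters of the half-plane with bottom row [v.2] that go on
    below it do so through such sites. *)
Definition exit om v : Prop := percolates om v.2 v /\ om ((v.1, v.2 - 1), true).

Definition lowest om v : Prop := percolates om v.2 v /\
  forall k u, conn om k v u -> v.2 <= u.2.

(** On the bottom row of a half-plane, these sites are used as representatives of
    the infinite clusters: they are chosen in a translation-equivariant way. *)
Definition leftmost om v : Prop := percolates om v.2 v /\
  forall u, u.2 = v.2 -> u.1 < v.1 -> ~ conn om v.2 v u.

Lemma lowest_site om k v : percolates om k v -> exists u,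
  [/\ conn om k v u, percolates om u.2 u & forall z, conn om k v z -> u.2 <= z.2].
Proof.
move=> pv; have kv := percolates_above pv.
have [_ [u <- vu] umin] := @int_min (fun y => exists2 u, u.2 = y & conn om k v u) k v.2
  (fun y => ltac:(by case=> u <- /conn_above; apply)) (ex_intro2 _ _ v erefl (conn_refl om k v)).
have {}umin z : conn om k v z -> u.2 <= z.2 by move=> c; apply: umin; exists z.
exists u; split => //; apply/percolatesE => n.
have /percolatesE/(_ n)[z uz nz] := percolates_conn vu pv.
exists z => //; apply: (@conn_ind om k (conn om u.2 u) _ _ _ uz); last exact: conn_refl.
move=> x y ux ux' s; apply: conn_trans ux' (conn_step _).
have vx := conn_trans vu ux; have vy := conn_trans vx (conn_step s).
by case/and3P: s => _ _ xy; rewrite /step xy !umin.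
Qed.

(** Without an exit, the cluster in the half-plane would be a whole cluster of the
    plane, and this one would have a lowest row. *)
Lemma exit_exists om k v : (forall z, ~ lowest om z) -> percolates om k v ->
  exists u, [/\ conn om k v u, u.2 = k & exit om u].
Proof.
move=> nl pv; apply: contrapT => ne.
have kv := percolates_above pv.
have closed j z : conn om j v z -> conn om k v z.
  move=> c; apply: (@conn_ind om j (conn om k v) _ _ _ c); last exact: conn_refl.
  move=> x y _ vx /and3P[_ _ xy].
  have kx := conn_above vx kv.
  case: (leP k y.2) => ky.
    by apply: conn_trans vx (conn_step _); rewrite /step kx ky.
  case: ne; exists x; split => //.
    by case/adjP: xy kx ky => -> _ /=; lia.
  split.
    suff -> : x.2 = k by exact: percolates_conn vx pv.
    by case/adjP: xy kx ky => -> _ /=; lia.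
  case/adjP: xy kx ky => -> o /=; try lia.
  by rewrite addrK; case: (y) o.
have [u [vu pu umin]] := lowest_site pv.
apply: (nl u); split => // j z uz; apply: umin.
apply: (closed (Num.min j k)); apply: (@conn_trans _ _ u).
  by apply: conn_le vu; rewrite ge_min lexx orbT.
by apply: conn_le uz; rewrite ge_min lexx.
Qed.

Lemma leftmost_unique om u v : leftmost om u -> leftmost om v -> u.2 = v.2 ->
  conn om u.2 u v -> u = v.
Proof.
move=> [_ ru] [_ rv] uv c; apply: site_eq => //.
case: (ltgtP u.1 v.1) => // h.
  by case: (rv u uv h); rewrite -uv; exact: conn_sym.
by case: (ru v (esym uv) h).
Qed.

Lemma leftmost_of_bounded om k v (m x : int) : percolates om k v ->
  conn om k v (x, k) -> (forall y, conn om k v (y, k) -> m <= y) ->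
  exists u, [/\ leftmost om u, u.2 = k & conn om k v u].
Proof.
move=> pv vx bm; have [r vr rmin] := @int_min (fun y => conn om k v (y, k)) m x bm vx.
exists (r, k); split => //; split => /=; first exact: percolates_conn vr pv.
move=> [y j] /= -> yr c; have := rmin y (conn_trans vr c); lia.
Qed.

Lemma conn_row om k v u : conn om k v u -> u.2 = k -> conn om k v (u.1, k).
Proof. by move=> c e; rewrite -[X in (_, X)]e -surjective_pairing. Qed.

(** Suppose that the cluster of [v] has no leftmost site.  Then it is unbounded to
    the left on row [k], and since clusters do not cross, all other infinite
    clusters lie to the right of one of its sites.  So does their leftmost site,
    which exists because there is another infinite cluster; but leftmost sites
    recur to the left. *)
Lemma leftmost_exists om k v1 v2 v : (forall z, ~ lowest om z) ->
  recurrent (-1, 0) (leftmost om) ->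
  percolates om k v1 -> percolates om k v2 -> ~ conn om k v1 v2 ->
  percolates om k v -> exists u, [/\ leftmost om u, u.2 = k & conn om k v u].
Proof.
move=> nl rl p1 p2 n12 pv; apply: contrapT => nr.
have [v' p' n'] : exists2 v', percolates om k v' & ~ conn om k v v'.
  case: (pselect (conn om k v v1)) => h; last by exists v1.
  by exists v2 => // h'; apply: n12; apply: conn_trans h'; exact: conn_sym.
have [b0 [vb0 kb _]] := exit_exists nl pv.
have [a0 [va0 ka _]] := exit_exists nl p'.
have vb := conn_row vb0 kb; have va := conn_row va0 ka.
move: (b0.1) (a0.1) vb va => b a vb va {b0 a0 vb0 kb va0 ka}.
have left M : exists2 x, x < M & conn om k v (x, k).
  apply: contrapT => nx; apply: nr; apply: (@leftmost_of_bounded _ _ _ M b) => // y vy.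
  by rewrite leNgt; apply/negP => yM; apply: nx; exists y.
(* all other infinite clusters lie to the right of [b] *)
have key x z : percolates om k z -> conn om k z (x, k) -> ~ conn om k v z -> b <= x.
  move=> pz zx nvz; rewrite leNgt; apply/negP => xb.
  have [y yx vy] := left x.
  have yb : conn om k (y, k) (b, k) by apply: conn_trans vb; exact: conn_sym.
  have := @noncrossing om k (y, k) (x, k) (b, k) erefl erefl erefl yx xb yb
    (percolates_conn zx pz) => yx'.
  by apply: nvz; apply: conn_trans vy (conn_trans yx' _); exact: conn_sym.
have [r [rr rk _]] : exists u, [/\ leftmost om u, u.2 = k & conn om k v' u].
  by apply: (@leftmost_of_bounded _ _ _ b a) => // y v'y; exact: (key y v').
have [m + rm] := recurrent_far (absz (r.1 - b)%R).+1 rl rr.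
rewrite addr_left rk in rm; move=> Mm.
have := key (r.1 - m%:Z) (r.1 - m%:Z, k).
have pm : percolates om k (r.1 - m%:Z, k) by case: rm.
move=> /(_ pm (conn_refl _ _ _)).
suff: ~ conn om k v (r.1 - m%:Z, k) by move=> h /(_ h); lia.
by move=> c; apply: nr; exists (r.1 - m%:Z, k).
Qed.

(** Since leftmost sites recur to the right and clusters do not cross, the cluster
    of [v] has finitely many sites on its bottom row.  Removing this row leaves
    finitely many clusters, and one of them has to be infinite.  The same is true
    for the next leftmost site to the right, so the half-plane above has two
    infinite clusters, and both have a leftmost site. *)
Lemma leftmost_child om v : (forall z, ~ lowest om z) ->
  recurrent (-1, 0) (leftmost om) -> recurrent (1, 0) (leftmost om) ->
  leftmost om v -> exists u, [/\ leftmost om u, u.2 = v.2 + 1 & conn om v.2 v u].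
Proof.
move=> nl rl rr rv.
have child z : leftmost om z -> exists2 u, conn om z.2 z u & percolates om (z.2 + 1) u.
  move=> rz; have [n] := rr z rz; rewrite addr_right; set z' : site := (_, _) => rz'.
  set j := z.2; have z'j : z'.2 = j by [].
  have nzz' : ~ conn om j z z'.
    by case: rz' => _ h c; apply: (h z) => //=; [lia|exact: conn_sym].
  have [pz hz] := rz.
  have row y : conn om j z y -> y.2 = j -> z.1 <= y.1 /\ y.1 < z'.1.
    move=> zy yj; split; [rewrite leNgt|rewrite ltNge]; apply/negP => h; first exact: (hz y).
    case: (ltgtP y.1 z'.1) => h'; try lia.
      apply: nzz'; apply: (@noncrossing om j z z' y) => //; last by case: rz'.
      by rewrite /z' /=; lia.
    by apply: nzz'; have <- : y = z' by apply: site_eq.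
  apply: contrapT => nu.
  have fin u : conn om j z u -> finite_set [set y | conn om (j + 1) u y].
    by move=> zu; apply: contrapT => pu; apply: nu; exists u.
  pose Rw : set site := [set y | conn om j z y /\ y.2 = j].
  have fRw : finite_set Rw.
    apply/finite_setE; exists (absz z.1 + absz z'.1 + absz j)%N => y [zy yj].
    by have := row y zy yj; rewrite /box; lia.
  (* the clusters of the half-plane above that hang on the bottom row *)
  pose W := Rw `|` \bigcup_(y in Rw `&` [set y | conn om j z (up y)])
    [set x | conn om (j + 1) (up y) x].
  apply: pz; apply: (@sub_finite_set _ _ W).
    move=> y /= zy; apply: (@conn_ind om j W z y _ zy); last by left; split; first exact: conn_refl.
    move=> s t zs Ws st; have zt := conn_trans zs (conn_step st).
    case/and3P: (st) => js jt a.
    have [tj|tj] : t.2 = j \/ j + 1 <= t.2 by lia.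
      by left.
    right; have [sj|sj] : s.2 = j \/ j + 1 <= s.2 by lia.
      have e : t = up s by case/adjP: a sj tj => -> _ //=; lia.
      by exists s; [split; [split|rewrite /= -e]|rewrite /= e; exact: conn_refl].
    case: Ws => [[_ ?]|[y' [[? ?] ?] /= c]]; first by lia.
    exists y' => //=; apply: conn_trans c (conn_step _).
    by rewrite /step sj tj.
  rewrite finite_setU; split => //; apply: bigcup_finite => [|y [_ zy]].
    by apply: sub_finite_set fRw => y [].
  exact: fin.
have [u vu pu] := child v rv.
have [n rn] := rr v rv; have [u' nu' pu'] := child _ rn.
rewrite addr_right /= in rn nu' pu'.
have nuu' : ~ conn om (v.2 + 1) u u'.
  move=> c; have /leftmost_unique : leftmost om v by [].
  have c' : conn om v.2 v (v.1 + n.+1%:Z, v.2).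
    apply: conn_trans vu (conn_trans _ (conn_sym nu')).
    by apply: conn_le c; rewrite ?lerDl //=; lia.
  by move=> /(_ _ rn erefl c') e; have := congr1 fst e => /=; lia.
have [r [rr' rk ur]] := leftmost_exists nl rl pu pu' nuu' pu.
exists r; split => //; apply: conn_trans vu _; apply: conn_le ur; lia.
Qed.

(** The mass at [v] is sent to one leftmost site [u] of the next row in the cluster
    of [v].  Minimality of the code of the displacement [u - v] makes the choice
    unique, and it commutes with translations. *)
Definition transported om v u : Prop := [/\ leftmost om v, leftmost om u, u.2 = v.2 + 1,
  conn om v.2 v u & forall u', leftmost om u' -> u'.2 = v.2 + 1 ->
    conn om v.2 v u' -> (pickle (u - v)%R <= pickle (u' - v)%R)%N].

Lemma transported_exists om v : (forall z, ~ lowest om z) ->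
  recurrent (-1, 0) (leftmost om) -> recurrent (1, 0) (leftmost om) ->
  leftmost om v -> exists u, transported om v u.
Proof.
move=> nl rl rr rv.
pose p n := `[< exists u, [/\ leftmost om u, u.2 = v.2 + 1,
  conn om v.2 v u & pickle (u - v) = n] >].
have e : exists n, p n.
  have [u [ru uk vu]] := leftmost_child nl rl rr rv.
  by exists (pickle (u - v)); apply/asboolP; exists u.
have [n /asboolP[u [ru uk vu un]] nmin] := ex_minnP e.
exists u; split => // u' ru' uk' vu'; rewrite un; apply: nmin.
by apply/asboolP; exists u'.
Qed.

(** Two leftmost sites of a row that are joined in the half-plane one row lower
    receive their mass from the same site, so they are equal.  Hence infinite
    clusters of a half-plane stay distinct in the plane; if there were two, then
    the leftmost sites would be a recurrent family of sites in distinct infinite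
    clusters. *)
Lemma percolation_unique om k u v : finitely_many_infinite_clusters om ->
  (forall z, ~ lowest om z) ->
  recurrent (-1, 0) (leftmost om) -> recurrent (1, 0) (leftmost om) ->
  (forall u, leftmost om u -> exists v, transported om v u) ->
  percolates om k u -> percolates om k v -> conn om k u v.
Proof.
move=> fin nl rl rr tr.
have merge j x y : percolates om j x -> percolates om j y -> conn om (j - 1) x y ->
    conn om j x y.
  move=> px py xy; apply: contrapT => nxy.
  have [x' [rx xk xx']] := leftmost_exists nl rl px py nxy px.
  have [y' [ry yk yy']] := leftmost_exists nl rl px py nxy py.
  have [s [rs _ xs sx' xmin]] := tr _ rx.
  have [t [rt _ yt ty' ymin]] := tr _ ry.
  have sj : s.2 = j - 1 by lia.
  have tj : t.2 = j - 1 by lia.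
  have le1 : j - 1 <= j by lia.
  have st : s = t.
    apply: (@leftmost_unique om); rewrite ?sj ?tj //.
    rewrite sj in sx'; rewrite tj in ty'.
    apply: conn_trans sx' _; apply: conn_trans (conn_le le1 (conn_sym xx')) _.
    by apply: conn_trans xy _; apply: conn_trans (conn_le le1 yy') (conn_sym ty').
  rewrite -st in ymin ty' yt.
  have : pickle (x' - s) = pickle (y' - s).
    by apply/eqP; rewrite eqn_leq xmin ?ymin.
  move=> /(pcan_inj pickleK)/addIr e; apply: nxy.
  by apply: conn_trans xx' _; rewrite e; exact: conn_sym.
have mergen (n : nat) x y : percolates om k x -> percolates om k y -> conn om (k - n%:Z) x y ->
    conn om k x y.
  move=> px py; elim: n => [|n IH]; first by rewrite subr0.
  move=> c; apply: IH; apply: merge.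
  - by apply: percolates_le px; lia.
  - by apply: percolates_le py; lia.
  - by move: c; congr conn; lia.
have plane j x y : percolates om k x -> percolates om k y -> conn om j x y -> conn om k x y.
  move=> px py c; case: (leP k j) => kj; first exact: conn_le c.
  apply: (mergen (absz (k - j)%R)) => //.
  by have -> : k - (absz (k - j)%R)%:Z = j by lia.
move=> pu pv; apply: contrapT => nuv.
have [r [rr' rk _]] := leftmost_exists nl rl pu pv nuv pu.
apply: (@no_recurrent_family om (1, 0) (fun v => leftmost om v /\ v.2 = k) fin _ _ _ _ r) => //.
- by left.
- by move=> x [[px _] _]; exact: percolates_cluster px.
- move=> x y [rx xk] [ry yk] /cluster_conn[j c]; apply: (@leftmost_unique om); rewrite ?xk ?yk //.
  by apply: plane c; [rewrite -xk; case: rx|rewrite -yk; case: ry].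
- by move=> x [rx xk]; have [n h] := rr x rx; exists n; split => //; rewrite addr_right.
Qed.

(** * Stationary events *)

Lemma equivariantW Q : (forall a om v, Q om (v - a) -> Q (translate a om) v) ->
  equivariant Q.
Proof.
move=> h a om v; split; last exact: h.
by move=> Qv; rewrite -(translateN a om); apply: h; rewrite opprK subrK.
Qed.

Lemma equivariant_lowest : equivariant lowest.
Proof.
apply: equivariantW => a om v [p h]; split; first exact/percolates_translate.
by move=> k u /conn_translate /h /=; lia.
Qed.

Lemma equivariant_leftmost : equivariant leftmost.
Proof.
apply: equivariantW => a om v [p h]; split; first exact/percolates_translate.
by move=> u uv uv1 /conn_translate; apply: h => /=; lia.
Qed.

Lemma equivariant_exit : equivariant exit.
Proof.
apply: equivariantW => a om v [p h]; split; first exact/percolates_translate.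
by move: h; rewrite /translate /=; congr (om (_, _)); apply: site_eq => /=; lia.
Qed.

Lemma transported_translate a om v u :
  transported (translate a om) v u <-> transported om (v - a) (u - a).
Proof.
suff H b om' x y : transported om' (x - b) (y - b) -> transported (translate b om') x y.
  split; last exact: H.
  by move=> t; rewrite -(translateN a om); apply: H; rewrite !opprK !subrK.
case=> rx ry xy c h; split.
- exact/equivariant_leftmost.
- exact/equivariant_leftmost.
- by move: xy => /=; lia.
- exact/conn_translate.
- move=> z /equivariant_leftmost rz zx /conn_translate xz.
  have := h _ rz; rewrite !opprB !addrA !subrK; apply=> //=; lia.
Qed.

Lemma measurable_lowest v : measurable [set om | lowest om v].
Proof.
rewrite /lowest; apply: measurable_and; first exact: measurable_percolates.
apply: measurable_forall => k; apply: measurable_forall => u.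
by apply: measurable_imp; [exact: measurable_conn|exact: measurable_const].
Qed.

Lemma measurable_leftmost v : measurable [set om | leftmost om v].
Proof.
rewrite /leftmost; apply: measurable_and; first exact: measurable_percolates.
apply: measurable_forall => u; apply: measurable_cond => _; apply: measurable_cond => _.
by apply: measurable_not; exact: measurable_conn.
Qed.

Lemma measurable_exit v : measurable [set om | exit om v].
Proof.
by rewrite /exit; apply: measurable_and; [exact: measurable_percolates|exact: measurable_open].
Qed.

Lemma measurable_transported v u : measurable [set om | transported om v u].
Proof.
apply: (@measurable_iff _ _ (fun om => (leftmost om v /\ leftmost om u) /\ ((u.2 = v.2 + 1 /\
  conn om v.2 v u) /\ forall u', leftmost om u' -> u'.2 = v.2 + 1 ->
    conn om v.2 v u' -> (pickle (u - v)%R <= pickle (u' - v)%R)%N))).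
  by move=> om; split=> [[[? ?] [[? ?] ?]]|[? ? ? ? ?]].
apply: measurable_and.
  by apply: measurable_and; exact: measurable_leftmost.
apply: measurable_and.
  by apply: measurable_and; [exact: measurable_const|exact: measurable_conn].
apply: measurable_forall => u'; apply: measurable_imp; first exact: measurable_leftmost.
apply: measurable_cond => _.
by apply: measurable_imp; [exact: measurable_conn|exact: measurable_const].
Qed.

(** * Almost sure structure of the primal clusters *)

Section ergodic.
Context {R : realType}.
Variable mu : probability (config Z2) R.
Hypothesis mu_inv : translation_invariant mu.

(** The events [A k] decrease with [k] and have the same probability, so almost
    surely they agree with each other and with their intersection, which is
    invariant under all translations. *)
Lemma zero_one : ergodic mu ->
  {ae mu, forall om, forall k, exists v, percolates om k v} \/
  {ae mu, forall om, forall k v, ~ percolates om k v}.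
Proof.
move=> erg; pose A k := [set om | exists v, percolates om k v].
have mA k : measurable (A k).
  by apply: measurable_exists => v; exact: measurable_percolates.
have eqA j k : mu (A j) = mu (A k).
  apply: (@equivariant_prob _ mu mu_inv (fun om v => exists u, percolates om v.2 u) (0, k) (0, j)).
    apply: equivariantW => a om v [u p]; exists (u + a).
    by apply/percolates_translate; rewrite addrK.
  exact: mA.
have {eqA} AA : {ae mu, forall om, forall j k, A j om -> A k om}.
  apply: (@ae_forall _ _ _ mu _ (fun j om => forall k, A j om -> A k om)) => j.
  apply: (@ae_forall _ _ _ mu _ (fun k om => A j om -> A k om)) => k.
  case: (leP k j) => kj.
    by apply: aeW => om [v p]; exists v; exact: percolates_le p.
  apply: ae_of_le => //; last by rewrite (eqA j k).
  by move=> om [v p]; exists v; apply: percolates_le p; exact: ltW.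
pose B := [set om | forall k, A k om].
have mB : measurable B by apply: measurable_forall.
have invB a : translate a @^-1` B = B.
  apply/funext => om; apply/propext; split => /= h k.
    by have [v /percolates_translate p] := h (k + a.2); exists (v - a); rewrite addrK in p.
  have [v p] := h (k - a.2); exists (v + a).
  by apply/percolates_translate; rewrite addrK.
case: (erg B mB invB) => [B0|B1]; [right|left].
  have nB : {ae mu, forall om, ~ B om}.
    by exists B; split => // om /= /contrapT.
  apply: ae_mp (ae_and AA nB) => om [AAom nBom] k v p; apply: nBom => j.
  by apply: (AAom k); exists v.
suff: {ae mu, forall om, B om} by [].
exists (~` B); split => //; first exact: measurableC.
by rewrite probability_setC // B1 subee.
Qed.

Hypothesis mu_fin : {ae mu, forall w, finitely_many_infinite_clusters w}.

(** On a fixed column, sites of this kind at different heights are in clusters with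
    different lowest rows. *)
Lemma ae_no_lowest : {ae mu, forall om, forall v, ~ lowest om v}.
Proof.
have rec := recurrence mu_inv (0, 1) equivariant_lowest measurable_lowest.
apply: ae_mp (ae_and rec mu_fin) => om [rl fin] v lv.
apply: (@no_recurrent_family om (0, 1) (fun u => lowest om u /\ u.1 = v.1) fin _ _ _ _ v) => //.
- by right.
- by move=> u [[p _] _]; exact: percolates_cluster p.
- move=> x y [[_ hx] x1] [[_ hy] y1] /cluster_conn[k c].
  have := hx _ _ c; have := hy _ _ (conn_sym c) => h1 h2.
  by apply: site_eq; lia.
- by move=> u [lu u1]; have [n h] := rl u lu; exists n; split => //; rewrite addr_up.
Qed.

Lemma ae_recurrent_leftmost a : {ae mu, forall om, recurrent a (leftmost om)}.
Proof. exact: recurrence equivariant_leftmost measurable_leftmost. Qed.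

Lemma ae_recurrent_exit a : {ae mu, forall om, recurrent a (exit om)}.
Proof. exact: recurrence equivariant_exit measurable_exit. Qed.

(** A leftmost site of row -1 sends its mass to a site of row 0, and a site of row
    0 receives mass at most once.  As leftmost sites have the same density on both
    rows, almost all of those on row 0 receive mass. *)
Lemma ae_transported : {ae mu, forall om, forall u, leftmost om u ->
  exists v, transported om v u}.
Proof.
pose Q om u := leftmost om u -> exists v, transported om v u.
have eQ : equivariant Q.
  apply: equivariantW => a om u h /equivariant_leftmost/h[v t].
  by exists (v + a); apply/transported_translate; rewrite addrK.
have mQ u : measurable [set om | Q om u].
  apply: measurable_imp; first exact: measurable_leftmost.
  by apply: measurable_exists => v; exact: measurable_transported.
suff Q0 : {ae mu, forall om, Q om (0, 0)}.
  apply: (@ae_forall _ _ _ mu _ (fun u om => Q om u)) => u.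
  apply: (ae_null (measurable_not (mQ u))).
  have enQ : equivariant (fun om u => ~ Q om u) by move=> a om x; rewrite eQ.
  rewrite (equivariant_prob mu_inv u enQ (measurable_not (mQ (0, 0)))).
  by apply: measure_negligible Q0; exact: measurable_not (mQ (0, 0)).
pose F (x : int) := [set om | transported om (0, -1) (x, 0)].
pose G (x : int) := [set om | transported om (- x, -1) (0, 0)].
have mF x : measurable (F x) by exact: measurable_transported.
have mG x : measurable (G x) by exact: measurable_transported.
have FG x : mu (F x) = mu (G x).
  rewrite -(mu_inv (- x, 0) (mG x)); congr (mu _); apply/funext => om; apply/propext.
  rewrite /G /F /preimage /= transported_translate.
  suff [-> ->] : ((- x, -1) - (- x, 0) : site) = (0, -1) /\
      ((0, 0) - (- x, 0) : site) = (x, 0) by [].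
  by split; apply: site_eq => /=; lia.
have tG : trivIset setT G.
  apply/trivIsetP => x y _ _ xy; apply/seteqP; split=> // om [[rx _ _ cx _] [ry _ _ cy _]].
  have /leftmost_unique : leftmost om (- x, -1) by [].
  move=> /(_ _ ry erefl (conn_trans cx (conn_sym cy)))[] /oppr_inj e.
  by rewrite e eqxx in xy.
have le1 := equal_disjoint_le mF mG FG tG.
have le2 : (mu [set om | leftmost om (0, -1)%R] <= mu (\bigcup_x F x))%E.
  apply: le_of_ae; first exact: measurable_leftmost.
    by apply: countable_bigcupT_measurable => // x; exact: countableP.
  have h := ae_and ae_no_lowest (ae_and (ae_recurrent_leftmost (-1, 0))
    (ae_recurrent_leftmost (1, 0))).
  apply: ae_mp h => om [nl [rl rr]] /= r0.
  have [[x y] t] := transported_exists nl rl rr r0.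
  exists x => //; rewrite /F /=; case: (t) => _ _ /= e _ _; have y0 : y = 0 by lia.
  by rewrite y0 in t.
have h : {ae mu, forall om, leftmost om (0, 0) -> (\bigcup_x G x) om}.
  apply: ae_of_le; first exact: measurable_leftmost.
  - by apply: countable_bigcupT_measurable => // x; exact: countableP.
  - by move=> om [x _ []].
  - rewrite (equivariant_prob mu_inv (0, 0) equivariant_leftmost (measurable_leftmost (0, -1))).
    exact: le_trans le2 le1.
by apply: ae_mp h => om h /h[x _ t]; exists (- x, -1).
Qed.

Lemma ae_percolation_unique : {ae mu, forall om, forall k u v,
  percolates om k u -> percolates om k v -> conn om k u v}.
Proof.
have h := ae_and (ae_and mu_fin ae_no_lowest) (ae_and ae_transported
  (ae_and (ae_recurrent_leftmost (-1, 0)) (ae_recurrent_leftmost (1, 0)))).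
apply: ae_mp h => om [[fin nl] [tr [rl rr]]] k u v.
exact: percolation_unique.
Qed.

(** Take a plaquette [q] on the lowest row of an infinite dual cluster.  The half-plane
    above row [q.2] has exits on both sides of [q], and they are connected in it. *)
Lemma ae_dual_blocked :
  {ae mu, forall om, forall k, exists v, percolates om k v} ->
  {ae mu, forall om, forall k v, ~ percolates (dual_config om) k v}.
Proof.
move=> perc.
have h := ae_and (ae_and perc ae_no_lowest) (ae_and ae_percolation_unique
  (ae_and (ae_recurrent_exit (-1, 0)) (ae_recurrent_exit (1, 0)))).
apply: ae_mp h => om [[ex nl] [un [el er]]] k q pq.
have [q' [_ {}pq _]] := lowest_site pq; move: q' pq => {k}q pq.
have [v pv] := ex (q.2 + 1).
have [x [vx xk ex0]] := exit_exists nl pv.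
have [m + el1] := recurrent_far (absz (x.1 - q.1)%R).+1 el ex0.
have [n + er1] := recurrent_far (absz (x.1 - q.1)%R).+1 er ex0.
rewrite addr_left in el1; rewrite addr_right in er1 => hn hm.
apply: (@dual_enclosed om _ _ q _ _ _ _ el1.2 er1.2 _ pq) => /=; try lia.
by apply: un; [case: el1|case: er1].
Qed.

End ergodic.

(** * Clusters of the half-plane graph *)

Lemma half_plane_open_adjacent om (x y : vertex half_plane) :
  open_adjacent (restrict_half_plane om) x y <-> step om 0 (sval x) (sval y).
Proof.
case: x y => [x hx] [y hy]; rewrite /step /= [_ <= _]hx [_ <= _]hy /=; split.
  case=> -[e [h1 h2]] [/= oe ee]; apply/open_adjacentE; exists e; split => //.
  by case: ee => -[<- <-]; [left|right]; exact: surjective_pairing.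
case/open_adjacentE => e [oe ee].
have he : 0 <= (endpoints e).1.2 /\ 0 <= (endpoints e).2.2.
  by case: ee => ->.
exists (exist _ e he); split => //.
case: ee => ee; [left|right]; congr pair; apply: eq_exist; by rewrite ee.
Qed.

Lemma half_plane_cluster om (x y : vertex half_plane) :
  Defs.cluster (restrict_half_plane om) x y <-> conn om 0 (sval x) (sval y).
Proof.
split.
  elim=> [s t /half_plane_open_adjacent|s|s t r _ h1 _ h2].
  - exact: conn_step.
  - exact: conn_refl.
  - exact: conn_trans h1 h2.
move=> c.
suff H : forall hy : 0 <= (sval y).2, Defs.cluster (restrict_half_plane om) x (exist _ (sval y) hy).
  by have := H (svalP y); congr (Defs.cluster _ _ _); case: (y) => ? ?; apply: eq_exist.
apply: (@conn_ind om 0 (fun z => forall hz : 0 <= z.2,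
  Defs.cluster (restrict_half_plane om) x (exist _ z hz)) _ _ _ c).
  move=> s t _ h st ht; have /and3P[hs _ _] := st.
  apply: rt_trans (h hs) _; apply: rt_step.
  exact/half_plane_open_adjacent.
move=> hx; suff -> : exist _ (sval x) hx = x by exact: rt_refl.
by case: x {c} hx => x hx hx'; apply: eq_exist.
Qed.

Lemma half_plane_infinite om (x : vertex half_plane) :
  infinite_set (Defs.cluster (restrict_half_plane om) x) <->
  percolates om 0 (sval x).
Proof.
have -> : percolates om 0 (sval x) =
    infinite_set (sval @` Defs.cluster (restrict_half_plane om) x).
  congr (~ finite_set _); apply/seteqP; split => [z c|_ [y /half_plane_cluster c <-]] //.
  have hz := conn_above c (svalP x).
  by exists (exist _ z hz) => //; apply/half_plane_cluster.
rewrite (eq_finite_set (inj_card_eq _)) // => s t _ _.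
by case: s t => s hs [t ht] /= e; apply: eq_exist.
Qed.

Lemma no_infinite_clusterE om : no_infinite_cluster (restrict_half_plane om) <->
  forall v, ~ percolates om 0 v.
Proof.
split=> [h v pv|h].
  have hv := percolates_above pv.
  suff : infinite_clusters (restrict_half_plane om)
      (Defs.cluster (restrict_half_plane om) (exist _ v hv)) by rewrite h.
  by split; [exists (exist _ v hv)|apply/half_plane_infinite].
by rewrite /no_infinite_cluster -subset0 => C [[x ->] /half_plane_infinite/h].
Qed.

Lemma cluster_eq (G : graph) (w : config G) (x y : vertex G) :
  Defs.cluster w x y -> Defs.cluster w y x -> Defs.cluster w x = Defs.cluster w y.
Proof.
by move=> xy yx; apply/seteqP; split=> z; apply: rt_trans.
Qed.

Lemma unique_infinite_clusterE om : unique_infinite_cluster (restrict_half_plane om) <->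
  (exists v, percolates om 0 v) /\
  forall u v, percolates om 0 u -> percolates om 0 v -> conn om 0 u v.
Proof.
split.
  case=> C [[[x Cx] Ci] uC]; split.
    by exists (sval x); apply/half_plane_infinite; rewrite -Cx.
  suff H u : percolates om 0 u -> conn om 0 (sval x) u.
    by move=> u v /H xu /H xv; apply: conn_trans (conn_sym xu) xv.
  move=> pu; have hu := percolates_above pu.
  have := uC (Defs.cluster (restrict_half_plane om) (exist _ u hu)).
  rewrite Cx => e; suff : Defs.cluster (restrict_half_plane om) x (exist _ u hu).
    by move/half_plane_cluster.
  rewrite e; first exact: rt_refl.
  by split; [exists (exist _ u hu)|apply/half_plane_infinite].
case=> -[v pv] un; have hv := percolates_above pv.
exists (Defs.cluster (restrict_half_plane om) (exist _ v hv)); split.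
  by split; [exists (exist _ v hv)|apply/half_plane_infinite].
move=> _ [[x ->] /half_plane_infinite px].
by apply: cluster_eq; apply/half_plane_cluster; exact: un.
Qed.

(** * Events of half-plane configurations *)

(** Restriction to the half-plane has a measurable section: all edges outside are
    given the state of one fixed edge. *)
Lemma measurable_half_plane (P : config half_plane -> Prop) :
  measurable [set om | P (restrict_half_plane om)] -> measurable [set w | P w].
Proof.
have hp0 : 0 <= (endpoints (((0, 0), false) : edge Z2)).1.2 /\
           0 <= (endpoints (((0, 0), false) : edge Z2)).2.2 by [].
pose h (e : edge Z2) : edge half_plane :=
  if pselect (0 <= (endpoints e).1.2 /\ 0 <= (endpoints e).2.2) is left he
  then exist _ e he else exist _ _ hp0.
pose ext (w : config half_plane) : config Z2 := fun e => w (h e).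
have extK w : restrict_half_plane (ext w) = w.
  apply/funext => -[e he]; rewrite /restrict_half_plane /ext /h /=; congr (w _).
  by case: pselect => // he'; exact: eq_exist.
have mext : measurable_fun setT ext by exact: (@measurable_reindex half_plane Z2 h id).
move=> /(mext measurableT); rewrite setTI.
by congr measurable; apply/funext => w; rewrite /preimage /= extK.
Qed.

Lemma measurable_no_infinite_cluster :
  measurable [set w : config half_plane | no_infinite_cluster w].
Proof.
apply: measurable_half_plane; apply: (@measurable_iff _ _
  (fun om => forall v, ~ percolates om 0 v)).
  by move=> om; exact: iff_sym (no_infinite_clusterE om).
by apply: measurable_forall => v; apply: measurable_not; exact: measurable_percolates.
Qed.

Lemma measurable_unique_infinite_cluster :
  measurable [set w : config half_plane | unique_infinite_cluster w].
Proof.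
apply: measurable_half_plane; apply: (@measurable_iff _ _
  (fun om => (exists v, percolates om 0 v) /\
  forall u v, percolates om 0 u -> percolates om 0 v -> conn om 0 u v)).
  by move=> om; exact: iff_sym (unique_infinite_clusterE om).
apply: measurable_and.
  by apply: measurable_exists => v; exact: measurable_percolates.
apply: measurable_forall => u; apply: measurable_forall => v.
apply: measurable_imp; first exact: measurable_percolates.
by apply: measurable_imp; [exact: measurable_percolates|exact: measurable_conn].
Qed.

(** * The dual measure *)

Lemma dual_translate a om :
  dual_config (translate a om) = translate a (dual_config om).
Proof.
by apply/funext => -[v []]; rewrite /dual_config /translate /primal_edge /= addrAC.
Qed.

Lemma measurable_dual_config (A : set (config Z2)) : measurable A ->
  measurable (dual_config @^-1` A).
Proof.
move=> mA; rewrite -[X in measurable X]setTI.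
exact: (@measurable_reindex Z2 Z2 primal_edge negb).
Qed.

Section dual.
Context {R : realType}.
Variable mu : probability (config Z2) R.

Lemma dual_translation_invariant : translation_invariant mu ->
  translation_invariant (dual_measure mu).
Proof.
move=> inv a A mA; rewrite /dual_measure /distribution /pushforward.
rewrite -[RHS](inv a _ (measurable_dual_config mA)); congr (mu _).
by apply/funext => om; rewrite /preimage /= dual_translate.
Qed.

Lemma dual_ergodic : ergodic mu -> ergodic (dual_measure mu).
Proof.
move=> erg A mA iA; apply: erg; first exact: measurable_dual_config.
move=> a; rewrite -[in RHS](iA a).
by apply/funext => om; rewrite /preimage /= dual_translate.
Qed.

End dual.

(** * The trichotomy *)

Theorem theorem1p2 (R : realType) (mu : probability (config Z2) R)
    (mu_inv : translation_invariant mu) (mu_erg : ergodic mu)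
    (mu_fin : {ae mu, forall w, finitely_many_infinite_clusters w}) :
  [\/ {ae half_plane_marginal mu, forall w, unique_infinite_cluster w} /\
       {ae half_plane_marginal (dual_measure mu),
          forall w, no_infinite_cluster w},
     {ae half_plane_marginal (dual_measure mu),
          forall w, unique_infinite_cluster w} /\
       {ae half_plane_marginal mu, forall w, no_infinite_cluster w}
   | {ae half_plane_marginal mu, forall w, no_infinite_cluster w} /\
       {ae half_plane_marginal (dual_measure mu),
          forall w, no_infinite_cluster w}].
Proof.
have mN := measurable_no_infinite_cluster.
have mU := measurable_unique_infinite_cluster.
have primalP := @ae_distribution _ _ _ _ _ mu restrict_half_plane.
have dualP (P : config half_plane -> Prop) : measurable [set w | P w] ->
    {ae mu, forall om, P (restrict_half_plane (dual_config om))} ->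
    {ae half_plane_marginal (dual_measure mu), forall w, P w}.
  move=> mP h; apply: ae_distribution => //; apply: ae_distribution => //.
  rewrite -[X in measurable X]setTI.
  exact: (@measurable_reindex Z2 half_plane sval id).
case: (zero_one mu_inv mu_erg) => [perc|noperc].
  constructor 1; split.
    apply: primalP => //; apply: ae_mp (ae_and perc (ae_percolation_unique mu_inv mu_fin)).
    by move=> om [ex un]; apply/unique_infinite_clusterE; split => //; exact: un.
  apply: dualP => //; apply: ae_mp (ae_dual_blocked mu_inv mu_fin perc) => om h.
  exact/no_infinite_clusterE.
have primal_none : {ae half_plane_marginal mu, forall w, no_infinite_cluster w}.
  apply: primalP => //; apply: ae_mp noperc => om h.
  exact/no_infinite_clusterE.
case: (zero_one (dual_translation_invariant mu_inv) (dual_ergodic mu_erg)) =>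
    /ae_distribution_inv dual.
  constructor 2; split => //.
  apply: dualP => //; apply: ae_mp (ae_and dual noperc) => om [ex np].
  apply/unique_infinite_clusterE; split => // u v pu pv.
  exact: dual_percolation_unique (np 0) pu pv.
constructor 3; split => //.
apply: dualP => //; apply: ae_mp dual => om h.
exact/no_infinite_clusterE.
Qed.
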